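(* Let $p(n)$ denote the number of partitions of $n$. For all integers $n>m>1$, \[ p(n)^2 - p(n-m)\,p(n+m) > 0. \]
   Context: $p(n)$ is the partition function: the number of ways of writing $n$ as an unordered sum of positive integers. *)

(* Defs.v *)
From mathcomp Require Import all_boot.
Set Implicit Arguments. Unset Strict Implicit. Unset Printing Implicit Defensive.

(* A partition of n (an unordered sum of positive integers equal to n) is
   encoded by its multiplicity function: c i = number of parts equal to i+1,
   for part sizes 1..n (no part can exceed n, and no multiplicity exceeds n).
   partition_number n = p(n) is the number of such multiplicity functions. *)
Definition partition_number (n : nat) : nat :=
  #|[set c : {ffun 'I_n -> 'I_n.+1} | \sum_(i < n) (i.+1 * c i) == n]|.

(* Main.v *)
(** Write [p(n) a^n] as the [n]-th Fourier coefficient of the generating function restricted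
    to the circle of radius [a].  Log-concavity at [n] follows, by AM-GM, from
    [2 p(n) > p(n-1) / a + a p(n+1)] for a single [a], that is, from the positivity of
    [J = int_0^pi |F(a e^(ix))| cos (arg F(a e^(ix)) - n x) (1 - cos x) dx].
    Take for [a] the saddle point.  Then each factor of [F] shows that [|F|] is at least the
    Gaussian given by its variance, and that the phase vanishes to third order at [0]; so the
    part of [J] near [0] is bounded below explicitly.  Elsewhere [|F(a e^(ix))| / F(a)] is at
    most [exp (- sum_k a^k (1 - cos (k x)))], which is negligible once [n >= 1852].  The values
    [26 <= n < 1852] are checked by computation.  Finally, if the ratios [p(i+1) / p(i)]
    decrease from [i = 25] on, then [p(j+m)^2 / (p(j) p(j+2m))] increases with [m] as soon as
    [j + m >= 25], and finitely many pairs [(j, m)] remain. *)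

From Stdlib Require Import Reals Lra Lia Psatz ZArith NArith List Ranalysis5.
From Coquelicot Require Import Coquelicot.
Require Import Defs.
Local Open Scope R_scope.

(** The analytic bound has to hold from an index that a table can reach, so constants matter and not
    only orders of growth. To keep them rational, the radius is written [a = b ^ 2] and the
    closeness to the unit circle is measured by [T = (1 - b ^ 2) / b]. The saddle point forces
    [T <= 3 / 100], and every numerical constant is tuned to that value. [F] is replaced by the
    finite product over part sizes up to [K]. It has the same coefficients up to index [K], so no
    infinite series occurs, and [K] can be taken so large that truncation errors are harmless.
    Complex values are replaced by a real modulus and a real argument, and Cauchy's formula by a
    recurrence in [K] between integrals over [[0, PI]]. Log-concavity is false at 25, since
    [p(25)^2 < p(24) p(26)]. Hence the table check can only start at centre 26, and the passage to
    general [m] must use ratios of [p] from index 25 on, even when [n - m] is small. *)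

(** * Comparison of integrals, and inequalities for [exp], [sin] and [cos] *)

Lemma derive_nonneg_le (f df : R -> R) (a b : R) :
  a <= b ->
  (forall x, a <= x <= b -> is_derive f x (df x)) ->
  (forall x, a <= x <= b -> 0 <= df x) -> f a <= f b.
Proof.
intros Hab Hd Hp.
destruct (MVT_gen f a b df) as [c [Hc Heq]].
- intros x Hx. apply Hd. rewrite Rmin_left, Rmax_right in Hx by lra. lra.
- intros x Hx. rewrite Rmin_left, Rmax_right in Hx by lra.
  apply derivable_continuous_pt. exists (df x). apply is_derive_Reals, Hd. lra.
- rewrite Rmin_left, Rmax_right in Hc by lra.
  assert (H := Hp c Hc). nra.
Qed.

Lemma RInt_le_antiderivative (f Q dQ : R -> R) (a b : R) :
  a <= b ->
  (forall x, continuous f x) ->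
  (forall x, a <= x <= b -> is_derive Q x (dQ x)) ->
  (forall x, a <= x <= b -> f x <= dQ x) -> RInt f a b <= Q b - Q a.
Proof.
intros Hab Hc Hd Hle.
assert (H : Q a - RInt f a a <= Q b - RInt f a b).
{ apply (derive_nonneg_le (fun x => Q x - RInt f a x) (fun x => dQ x - f x)); trivial.
  - intros x Hx. apply (is_derive_minus (K := R_AbsRing) (V := R_NormedModule)).
    + now apply Hd.
    + apply is_derive_RInt with a; [|apply Hc].
      apply filter_forall. intros y. apply (RInt_correct (V := R_CompleteNormedModule)).
      apply ex_RInt_continuous. intros; apply Hc.
  - intros x Hx. specialize (Hle x Hx). lra. }
rewrite RInt_point in H. unfold zero in H; simpl in H. lra.
Qed.

Lemma RInt_ge_antiderivative (f Q dQ : R -> R) (a b : R) :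
  a <= b ->
  (forall x, continuous f x) ->
  (forall x, a <= x <= b -> is_derive Q x (dQ x)) ->
  (forall x, a <= x <= b -> dQ x <= f x) -> Q b - Q a <= RInt f a b.
Proof.
intros Hab Hc Hd Hle.
assert (H : RInt (fun x => - f x) a b <= - Q b - - Q a).
{ apply (RInt_le_antiderivative _ (fun x => - Q x) (fun x => - dQ x)); trivial.
  - intros x. apply (continuous_opp (V := R_NormedModule)), Hc.
  - intros x Hx. apply (is_derive_opp (K := R_AbsRing) (V := R_NormedModule)), Hd, Hx.
  - intros x Hx. specialize (Hle x Hx). lra. }
rewrite (RInt_opp (V := R_CompleteNormedModule)) in H.
- unfold opp in H; simpl in H. lra.
- apply ex_RInt_continuous. intros; apply Hc.
Qed.

(** After multiplication by [exp (- s)] this is [sinh s <= s cosh s]. *)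
Lemma exp_double_le (s : R) : 0 <= s < 1 -> exp (2 * s) <= (1 + s) / (1 - s).
Proof.
intros Hs.
assert (H : (1 + 0) * exp (- 0) - (1 - 0) * exp 0 <= (1 + s) * exp (- s) - (1 - s) * exp s).
{ apply (derive_nonneg_le (fun x => (1 + x) * exp (- x) - (1 - x) * exp x)
     (fun x => x * (exp x - exp (- x)))); [lra| |].
  - intros x _. auto_derive; trivial. ring.
  - intros x Hx. apply Rmult_le_pos; [lra|].
    assert (exp (- x) <= exp x); [|lra].
    destruct (Req_dec x 0) as [->|]; [rewrite Ropp_0; lra|].
    left; apply exp_increasing; lra. }
rewrite Ropp_0, exp_0 in H.
apply Rmult_le_reg_r with (1 - s); [lra|].
replace ((1 + s) / (1 - s) * (1 - s)) with (1 + s) by (field; lra).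
replace (2 * s) with (s + s) by ring. rewrite exp_plus.
assert (E := exp_pos s).
assert (E2 : exp (- s) * exp s = 1) by (rewrite <- exp_plus, Rplus_opp_l; apply exp_0).
assert (H3 : ((1 - s) * exp s) * exp s <= ((1 + s) * exp (- s)) * exp s)
  by (apply Rmult_le_compat_r; lra).
rewrite (Rmult_assoc (1 + s)), E2 in H3. lra.
Qed.

Lemma exp_ge_cubic (x : R) : 0 <= x -> 1 + x + x ^ 2 / 2 + x ^ 3 / 6 <= exp x.
Proof.
assert (H1 : forall x, 0 <= x -> 1 + x <= exp x).
{ intros y Hy. destruct (Req_dec y 0) as [->|]; [rewrite exp_0; lra|].
  left. apply exp_ineq1; lra. }
assert (H2 : forall x, 0 <= x -> 1 + x + x ^ 2 / 2 <= exp x).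
{ intros y Hy.
  assert (H : exp 0 - (1 + 0 + 0 ^ 2 / 2) <= exp y - (1 + y + y ^ 2 / 2)).
  { apply (derive_nonneg_le (fun x => exp x - (1 + x + x ^ 2 / 2)) (fun x => exp x - (1 + x)));
      trivial.
    - intros z _. auto_derive; trivial. field.
    - intros z Hz. specialize (H1 z (proj1 Hz)). lra. }
  rewrite exp_0 in H. lra. }
intros Hx.
assert (H : exp 0 - (1 + 0 + 0 ^ 2 / 2 + 0 ^ 3 / 6) <= exp x - (1 + x + x ^ 2 / 2 + x ^ 3 / 6)).
{ apply (derive_nonneg_le (fun x => exp x - (1 + x + x ^ 2 / 2 + x ^ 3 / 6))
     (fun x => exp x - (1 + x + x ^ 2 / 2))); trivial.
  - intros y _. auto_derive; trivial. field.
  - intros y Hy. specialize (H2 y (proj1 Hy)). lra. }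
rewrite exp_0 in H. lra.
Qed.

Lemma exp_pow (x : R) (n : nat) : exp x ^ n = exp (INR n * x).
Proof.
induction n as [|n IH]; [simpl; now rewrite Rmult_0_l, exp_0|].
rewrite S_INR, Rmult_plus_distr_r, Rmult_1_l, exp_plus, <- IH. simpl. ring.
Qed.

Lemma cos_ge_quadratic (x : R) : 0 <= x -> 1 - x ^ 2 / 2 <= cos x.
Proof.
intros Hx.
assert (H : cos 0 - (1 - 0 ^ 2 / 2) <= cos x - (1 - x ^ 2 / 2)).
{ apply (derive_nonneg_le (fun x => cos x - (1 - x ^ 2 / 2)) (fun x => x - sin x)); trivial.
  - intros y _. auto_derive; trivial. field.
  - intros y Hy. destruct (Req_dec y 0) as [->|]; [rewrite sin_0; lra|].
    assert (sin y < y) by (apply sin_lt_x; lra). lra. }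
rewrite cos_0 in H. lra.
Qed.

Lemma sin_ge_cubic (x : R) : 0 <= x -> x - x ^ 3 / 6 <= sin x.
Proof.
intros Hx.
assert (H : sin 0 - (0 - 0 ^ 3 / 6) <= sin x - (x - x ^ 3 / 6)).
{ apply (derive_nonneg_le (fun x => sin x - (x - x ^ 3 / 6)) (fun x => cos x - (1 - x ^ 2 / 2)));
    trivial.
  - intros y _. auto_derive; trivial. field.
  - intros y Hy. assert (H := cos_ge_quadratic y (proj1 Hy)). lra. }
rewrite sin_0 in H. lra.
Qed.

Lemma cos_le_quartic (x : R) : 0 <= x -> cos x <= 1 - x ^ 2 / 2 + x ^ 4 / 24.
Proof.
intros Hx.
assert (H : (1 - 0 ^ 2 / 2 + 0 ^ 4 / 24) - cos 0 <= (1 - x ^ 2 / 2 + x ^ 4 / 24) - cos x).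
{ apply (derive_nonneg_le (fun x => (1 - x ^ 2 / 2 + x ^ 4 / 24) - cos x)
    (fun x => sin x - (x - x ^ 3 / 6))); trivial.
  - intros y _. auto_derive; trivial. field.
  - intros y Hy. assert (H := sin_ge_cubic y (proj1 Hy)). lra. }
rewrite cos_0 in H. lra.
Qed.

(** * Counting partitions by largest part size *)

(** Partitions of [n] with all parts at most [K]. The inner recursion removes one part [S K] at a
    time, so fuel [n] never runs out early; [npart_S] is the recurrence without fuel. *)
Fixpoint npart (K : nat) : nat -> nat :=
  match K with
  | O => fun n => match n with O => 1%nat | S _ => 0%nat end
  | S K' => fun n =>
      (fix go (fuel m : nat) : nat :=
         (npart K' m + match fuel with
                       | O => 0
                       | S fuel' => if S K' <=? m then go fuel' (m - S K') else 0
                       end)%nat) n n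
  end.

Lemma npart_S (K n : nat) :
  npart (S K) n = (npart K n + if S K <=? n then npart (S K) (n - S K) else 0)%nat.
Proof.
cbn [npart].
set (go := fix go (fuel m : nat) : nat := (npart K m + _)%nat).
assert (Hgo : forall f g m, (m <= f)%nat -> (m <= g)%nat -> go f m = go g m).
{ intros f. induction f as [|f IH]; intros [|g] m Hf Hg; cbn -[Nat.leb]; trivial.
  - destruct (Nat.leb_spec (S K) m); lia.
  - destruct (Nat.leb_spec (S K) m); lia.
  - destruct (Nat.leb_spec (S K) m); trivial. rewrite (IH g); lia. }
destruct n as [|n]; [reflexivity|].
cbn -[Nat.leb Nat.sub]. destruct (Nat.leb_spec (S K) (S n)); trivial.
f_equal. apply Hgo; lia.
Qed.

Lemma npart_stable (K n : nat) : (n <= K)%nat -> npart K n = npart n n.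
Proof.
induction 1 as [|K HK IH]; trivial.
rewrite npart_S. destruct (Nat.leb_spec (S K) n); lia.
Qed.

Lemma npart_pos (K n : nat) : (0 < K)%nat -> (0 < npart K n)%nat.
Proof.
assert (H1 : forall m, npart 1 m = 1%nat).
{ intros m. induction m as [|m IH]; [reflexivity|].
  rewrite npart_S. replace (S m - 1)%nat with m by lia. rewrite IH. reflexivity. }
induction K as [|[|K] IH]; intros HK; [lia|rewrite H1; lia|].
rewrite npart_S. specialize (IH ltac:(lia)). lia.
Qed.

(** * Modulus and argument of the generating function *)

(** This is [|1 - a e^(iu)|^2], written as its minimum, at [u = 0], plus a nonnegative excess. *)
Definition rho2 (a u : R) : R := (1 - a) ^ 2 + 2 * a * (1 - cos u).

(* [1 / (1 - a e^(iu)) = geom_mod a u * e^(i * geom_arg a u)] *)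
Definition geom_mod (a u : R) : R := / sqrt (rho2 a u).
Definition geom_arg (a u : R) : R := atan (a * sin u / (1 - a * cos u)).

Fixpoint gf_mod (a : R) (K : nat) (x : R) : R :=
  match K with
  | O => 1
  | S k => gf_mod a k x * geom_mod (a ^ S k) (INR (S k) * x)
  end.

(** A sum of principal arguments, not the principal argument of the product: this branch is
    continuous in [x] and vanishes at 0. *)
Fixpoint gf_arg (a : R) (K : nat) (x : R) : R :=
  match K with
  | O => 0
  | S k => gf_arg a k x + geom_arg (a ^ S k) (INR (S k) * x)
  end.

Lemma rho2_ge (a u : R) : 0 <= a -> (1 - a) ^ 2 <= rho2 a u.
Proof. intros Ha. unfold rho2. assert (H := COS_bound u). nra. Qed.

Lemma rho2_pos (a u : R) : 0 <= a < 1 -> 0 < rho2 a u.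
Proof. intros Ha. assert (H := rho2_ge a u). nra. Qed.

Lemma one_minus_mul_cos_pos (a u : R) : 0 <= a < 1 -> 0 < 1 - a * cos u.
Proof. intros Ha. assert (H := COS_bound u). nra. Qed.

Lemma rho2_sum_squares (a u : R) : rho2 a u = (1 - a * cos u) ^ 2 + (a * sin u) ^ 2.
Proof.
unfold rho2. assert (H := sin2_cos2 u). unfold Rsqr in H.
replace ((a * sin u) ^ 2) with (a ^ 2 * (sin u * sin u)) by ring.
replace (sin u * sin u) with (1 - cos u * cos u) by lra. ring.
Qed.

Lemma geom_mod_pos (a u : R) : 0 <= a < 1 -> 0 < geom_mod a u.
Proof. intros Ha. apply Rinv_0_lt_compat, sqrt_lt_R0, rho2_pos, Ha. Qed.

(** Real and imaginary parts of [1 / (1 - a e^(iu))]. The real part is positive, so [atan] picks the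
    right branch. *)
Lemma geom_mod_cos_arg (a u : R) : 0 <= a < 1 ->
  geom_mod a u * cos (geom_arg a u) = (1 - a * cos u) / rho2 a u /\
  geom_mod a u * sin (geom_arg a u) = a * sin u / rho2 a u.
Proof.
intros Ha.
assert (Hp := one_minus_mul_cos_pos a u Ha).
assert (Hr := rho2_pos a u Ha).
assert (Hs : sqrt (1 + (a * sin u / (1 - a * cos u))²) = sqrt (rho2 a u) / (1 - a * cos u)).
{ rewrite <- (sqrt_Rsqr (1 - a * cos u)) at 2 by lra.
  rewrite <- sqrt_div_alt by (apply Rlt_0_sqr; lra).
  f_equal. rewrite rho2_sum_squares. unfold Rsqr. field. lra. }
assert (Hq : 0 < sqrt (rho2 a u)) by now apply sqrt_lt_R0.
assert (Hqq : sqrt (rho2 a u) * sqrt (rho2 a u) = rho2 a u) by (apply sqrt_sqrt; lra).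
unfold geom_arg, geom_mod. rewrite cos_atan, sin_atan, Hs.
set (q := sqrt (rho2 a u)) in *. rewrite <- Hqq. split; field; lra.
Qed.

(** Real part of [e^(iy) * (1 - a e^(iu)) / (1 - a e^(iu)) = e^(iy)]. *)
Lemma geom_twist (a u y : R) : 0 <= a < 1 ->
  geom_mod a u * (cos (y + geom_arg a u) - a * cos (y + geom_arg a u + u)) = cos y.
Proof.
intros Ha. destruct (geom_mod_cos_arg a u Ha) as [Hc Hs].
assert (Hr := rho2_pos a u Ha). assert (Hr2 := rho2_sum_squares a u).
rewrite (cos_plus (y + _)), (cos_plus y), (sin_plus y).
set (g := geom_mod a u) in *. set (cb := cos (geom_arg a u)) in *.
set (sb := sin (geom_arg a u)) in *.
transitivity (cos y * ((g * cb) * (1 - a * cos u) + (g * sb) * (a * sin u))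
  + sin y * ((g * cb) * (a * sin u) - (g * sb) * (1 - a * cos u))); [ring|].
rewrite Hc, Hs.
transitivity (cos y * (((1 - a * cos u) ^ 2 + (a * sin u) ^ 2) / rho2 a u)); [field; lra|].
rewrite <- Hr2. field. lra.
Qed.

Lemma pow_in_unit (a : R) (k : nat) : 0 < a < 1 -> 0 < a ^ S k < 1.
Proof.
intros Ha. split; [apply pow_lt; lra|].
simpl. assert (H : a ^ k <= 1) by (rewrite <- (pow1 k); apply pow_incr; lra).
assert (0 < a ^ k) by (apply pow_lt; lra). nra.
Qed.

Lemma gf_mod_pos (a : R) (K : nat) (x : R) : 0 < a < 1 -> 0 < gf_mod a K x.
Proof.
intros Ha. induction K as [|K IH]; [simpl; lra|].
cbn [gf_mod]. apply Rmult_lt_0_compat; trivial.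
apply geom_mod_pos. assert (H := pow_in_unit a K Ha). lra.
Qed.

Lemma continuous_geom_mod (a c x : R) : 0 <= a < 1 ->
  continuous (fun x => geom_mod a (c * x)) x.
Proof.
intros Ha. apply (ex_derive_continuous (K := R_AbsRing) (V := R_NormedModule)).
unfold geom_mod, rho2. assert (H := rho2_pos a (c * x) Ha). unfold rho2 in H.
auto_derive. split; [exact H|]. split; trivial.
apply Rgt_not_eq, sqrt_lt_R0. exact H.
Qed.

Lemma continuous_geom_arg (a c x : R) : 0 <= a < 1 ->
  continuous (fun x => geom_arg a (c * x)) x.
Proof.
intros Ha. apply (ex_derive_continuous (K := R_AbsRing) (V := R_NormedModule)).
unfold geom_arg. assert (H := one_minus_mul_cos_pos a (c * x) Ha).
auto_derive. lra.
Qed.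

Lemma continuous_gf_mod (a : R) (K : nat) (x : R) : 0 < a < 1 -> continuous (gf_mod a K) x.
Proof.
intros Ha. induction K as [|K IH]; [apply continuous_const|].
cbn [gf_mod]. apply (continuous_mult (K := R_AbsRing)); trivial.
apply continuous_geom_mod. assert (H := pow_in_unit a K Ha). lra.
Qed.

Lemma continuous_gf_arg (a : R) (K : nat) (x : R) : 0 < a < 1 -> continuous (gf_arg a K) x.
Proof.
intros Ha. induction K as [|K IH]; [apply continuous_const|].
cbn [gf_arg]. apply (continuous_plus (V := R_NormedModule)); trivial.
apply continuous_geom_arg. assert (H := pow_in_unit a K Ha). lra.
Qed.

Lemma continuous_twisted_gf (a : R) (K : nat) (y x : R) : 0 < a < 1 ->
  continuous (fun x => gf_mod a K x * cos (gf_arg a K x - y * x)) x.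
Proof.
intros Ha. apply (continuous_mult (K := R_AbsRing)); [now apply continuous_gf_mod|].
apply (continuous_comp (fun x => gf_arg a K x - y * x) cos).
- apply (continuous_minus (V := R_NormedModule)); [now apply continuous_gf_arg|].
  apply (continuous_mult (K := R_AbsRing)); [apply continuous_const|apply continuous_id].
- apply continuity_pt_filterlim, continuity_cos.
Qed.

(** * Partition numbers as Fourier integrals *)

(** Half of the Fourier integral over a full period, the real part of the integrand being even in
    [x]. The index is real because the recurrence lowers it below 0. *)
Definition fourier (a : R) (K : nat) (y : R) : R :=
  RInt (fun x => gf_mod a K x * cos (gf_arg a K x - y * x)) 0 PI.

Lemma ex_RInt_twisted_gf (a : R) (K : nat) (y u v : R) : 0 < a < 1 ->
  ex_RInt (fun x => gf_mod a K x * cos (gf_arg a K x - y * x)) u v.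
Proof.
intros Ha. apply (ex_RInt_continuous (V := R_CompleteNormedModule)).
intros; now apply continuous_twisted_gf.
Qed.

(** Integrated form of [F_K = (1 - q^(K+1)) F_(K+1)] at [q = a e^(ix)], by [geom_twist]. *)
Lemma fourier_rec (a : R) (K : nat) (y : R) : 0 < a < 1 ->
  fourier a (S K) y = fourier a K y + a ^ S K * fourier a (S K) (y - INR (S K)).
Proof.
intros Ha. unfold fourier.
rewrite <- (RInt_scal (V := R_CompleteNormedModule)) by now apply ex_RInt_twisted_gf.
rewrite <- (RInt_plus (V := R_CompleteNormedModule)).
- apply RInt_ext. intros x _. unfold plus, scal; simpl; unfold mult; simpl.
  change (INR (S K)) with (match K with O => 1 | S _ => INR K + 1 end).
  change (a * a ^ K) with (a ^ S K).
  set (c := match K with O => 1 | S _ => _ end).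
  assert (HK := geom_twist (a ^ S K) (c * x) (gf_arg a K x - y * x)).
  rewrite <- HK by (assert (H := pow_in_unit a K Ha); lra).
  replace (gf_arg a K x + geom_arg (a ^ S K) (c * x) - y * x)
    with (gf_arg a K x - y * x + geom_arg (a ^ S K) (c * x)) by ring.
  replace (gf_arg a K x + geom_arg (a ^ S K) (c * x) - (y - c) * x)
    with (gf_arg a K x - y * x + geom_arg (a ^ S K) (c * x) + c * x) by ring.
  ring.
- now apply ex_RInt_twisted_gf.
- apply (ex_RInt_scal (V := R_NormedModule)). now apply ex_RInt_twisted_gf.
Qed.

Lemma fourier_bounded (a : R) (K : nat) (y : R) : 0 < a < 1 ->
  Rabs (fourier a K y) <= RInt (gf_mod a K) 0 PI.
Proof.
intros Ha. unfold fourier. assert (HPI := PI_RGT_0).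
assert (Hex : ex_RInt (gf_mod a K) 0 PI).
{ apply (ex_RInt_continuous (V := R_CompleteNormedModule)).
  intros; now apply continuous_gf_mod. }
apply Rabs_le. split.
- rewrite <- (RInt_opp (V := R_CompleteNormedModule)) by exact Hex.
  apply RInt_le; [lra| |now apply ex_RInt_twisted_gf|].
  + now apply (ex_RInt_opp (V := R_NormedModule)).
  + intros x _. unfold opp; simpl. assert (H := gf_mod_pos a K x Ha).
    assert (H2 := COS_bound (gf_arg a K x - y * x)). nra.
- apply RInt_le; [lra|now apply ex_RInt_twisted_gf|exact Hex|].
  intros x _. assert (H := gf_mod_pos a K x Ha).
  assert (H2 := COS_bound (gf_arg a K x - y * x)). nra.
Qed.

Lemma eq0_of_geometric_bound (x q C : R) : 0 < q < 1 ->
  (forall i, Rabs x <= q ^ i * C) -> x = 0.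
Proof.
intros Hq H. destruct (Req_dec x 0) as [|Hx]; trivial. exfalso.
assert (Hp : 0 < Rabs x) by now apply Rabs_pos_lt.
assert (HC : 0 < C) by (specialize (H 0%nat); simpl in H; lra).
destruct (pow_lt_1_zero q) with (y := Rabs x / C) as [N HN].
- rewrite Rabs_pos_eq; lra.
- now apply Rdiv_lt_0_compat.
- specialize (HN N (le_n N)). rewrite Rabs_pos_eq in HN by (apply pow_le; lra).
  apply (Rmult_lt_compat_r C) in HN; trivial.
  replace (Rabs x / C * C) with (Rabs x) in HN by (field; lra).
  specialize (H N). lra.
Qed.

Lemma fourier_0 (a : R) : fourier a 0 0 = PI.
Proof.
unfold fourier. rewrite (RInt_ext _ (fun _ => 1)).
- rewrite RInt_const. change ((PI - 0) * 1 = PI). ring.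
- intros x _. cbn [gf_mod gf_arg]. replace (0 - 0 * x) with 0 by ring.
  rewrite cos_0. apply Rmult_1_r.
Qed.

Lemma fourier_0_nonzero (a : R) (z : Z) : z <> 0%Z -> fourier a 0 (IZR z) = 0.
Proof.
intros Hz. assert (Hz' : IZR z <> 0) by now apply not_0_IZR.
unfold fourier. apply is_RInt_unique.
replace 0 with (minus (sin (IZR z * PI) / IZR z) (sin (IZR z * 0) / IZR z)) at 2.
- apply (is_RInt_derive (fun x => sin (IZR z * x) / IZR z)).
  + intros x _. auto_derive; trivial. cbn [gf_mod gf_arg].
    rewrite Rminus_0_l, cos_neg. now field.
  + intros x _. apply (continuous_mult (K := R_AbsRing)); [apply continuous_const|].
    apply (continuous_comp (fun x => gf_arg a 0 x - IZR z * x) cos).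
    * apply (continuous_minus (V := R_NormedModule)); [apply continuous_const|].
      apply (continuous_mult (K := R_AbsRing)); [apply continuous_const|apply continuous_id].
    * apply continuity_pt_filterlim, continuity_cos.
- rewrite Rmult_0_r, sin_0, sin_eq_0_1 by now exists z.
  unfold minus, plus, opp; simpl. now field.
Qed.

(* A negative index moves to [-oo] under the recurrence, gaining a factor [a ^ S K] each time. *)
Lemma fourier_neg (a : R) (K : nat) (z : Z) : 0 < a < 1 -> (z < 0)%Z ->
  fourier a K (IZR z) = 0.
Proof.
intros Ha. revert z. induction K as [|K IH]; intros z Hz.
- apply fourier_0_nonzero. lia.
- apply (eq0_of_geometric_bound _ (a ^ S K) (RInt (gf_mod a (S K)) 0 PI)).
  + now apply pow_in_unit.
  + intros i. revert z Hz. induction i as [|i IHi]; intros z Hz.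
    * rewrite pow_O, Rmult_1_l. now apply fourier_bounded.
    * rewrite fourier_rec, IH, Rplus_0_l by assumption.
      rewrite INR_IZR_INZ, <- minus_IZR, Rabs_mult, Rabs_pos_eq
        by (left; now apply pow_in_unit).
      change ((a ^ S K) ^ S i) with (a ^ S K * (a ^ S K) ^ i).
      rewrite (Rmult_assoc (a ^ S K)). apply Rmult_le_compat_l.
      -- left; now apply pow_in_unit.
      -- apply IHi. lia.
Qed.

(** [fourier_rec] and [npart_S] are the same recurrence up to the weight [a ^ n]. When [n < S K],
    the term missing from [npart_S] is zero by [fourier_neg]. *)
Lemma fourier_npart (a : R) (K n : nat) : 0 < a < 1 ->
  fourier a K (INR n) = PI * INR (npart K n) * a ^ n.
Proof.
intros Ha. revert n. induction K as [|K IH]; intros n.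
- destruct n as [|n]; [rewrite fourier_0; simpl; ring|].
  rewrite INR_IZR_INZ, fourier_0_nonzero by lia. simpl. ring.
- induction n as [n IHn] using (well_founded_induction lt_wf).
  rewrite fourier_rec, IH, npart_S by assumption.
  destruct (Nat.leb_spec (S K) n) as [Hn|Hn].
  + rewrite <- minus_INR, IHn, plus_INR by lia.
    replace (a ^ n) with (a ^ S K * a ^ (n - S K)) by (rewrite <- pow_add; f_equal; lia).
    ring.
  + rewrite !INR_IZR_INZ, <- minus_IZR, fourier_neg by (assumption || lia).
    rewrite Nat.add_0_r. ring.
Qed.

(* For any [a], AM-GM turns concavity of the tilted sequence [npart K i * a ^ i] at [i = n]
   into log-concavity. *)
Lemma npart_logconcave_of_integral (a : R) (K n : nat) : 0 < a < 1 ->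
  0 < RInt (fun x => gf_mod a K x * cos (gf_arg a K x - INR (S n) * x) * (1 - cos x)) 0 PI ->
  INR (npart K n) * INR (npart K (S (S n))) < INR (npart K (S n)) ^ 2.
Proof.
intros Ha HJ. assert (HPI := PI_RGT_0).
(* The weight [1 - cos x] takes a second difference in the index: [2 cos y (1 - cos x) = 2 cos y -
   cos (y + x) - cos (y - x)]. *)
assert (E : 2 * RInt (fun x => gf_mod a K x * cos (gf_arg a K x - INR (S n) * x)
                                * (1 - cos x)) 0 PI
  = 2 * fourier a K (INR (S n)) - (fourier a K (INR n) + fourier a K (INR (S (S n))))).
{ unfold fourier.
  rewrite <- (RInt_plus (V := R_CompleteNormedModule)) by now apply ex_RInt_twisted_gf.
  rewrite <- (RInt_scal (V := R_CompleteNormedModule) _ _ _ 2) at 1.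
  2: { apply (ex_RInt_continuous (V := R_CompleteNormedModule)). intros x _.
    apply (continuous_mult (K := R_AbsRing)); [now apply continuous_twisted_gf|].
    apply (continuous_minus (V := R_NormedModule)); [apply continuous_const|].
    apply continuity_pt_filterlim, continuity_cos. }
  change (2 * RInt ?f 0 PI) with (scal 2 (RInt f 0 PI)).
  rewrite <- (RInt_scal (V := R_CompleteNormedModule)) by now apply ex_RInt_twisted_gf.
  rewrite <- (RInt_minus (V := R_CompleteNormedModule)).
  - apply RInt_ext. intros x _.
    set (g := gf_mod a K x). set (A := gf_arg a K x).
    change (2 * (g * cos (A - INR (S n) * x) * (1 - cos x))
      = 2 * (g * cos (A - INR (S n) * x))
        - (g * cos (A - INR n * x) + g * cos (A - INR (S (S n)) * x))).
    rewrite !S_INR.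
    replace (A - INR n * x) with (A - (INR n + 1) * x + x) by ring.
    replace (A - (INR n + 1 + 1) * x) with (A - (INR n + 1) * x - x)
      by ring.
    set (y := A - (INR n + 1) * x).
    rewrite cos_plus, cos_minus. ring.
  - apply (ex_RInt_scal (V := R_NormedModule)). now apply ex_RInt_twisted_gf.
  - apply (ex_RInt_plus (V := R_NormedModule)); now apply ex_RInt_twisted_gf. }
rewrite !fourier_npart in E by assumption.
set (p0 := INR (npart K n)) in *. set (p1 := INR (npart K (S n))) in *.
set (p2 := INR (npart K (S (S n)))) in *.
assert (Hp0 : 0 <= p0) by apply pos_INR. assert (Hp2 : 0 <= p2) by apply pos_INR.
assert (Ht : 0 < PI * a ^ n) by (apply Rmult_lt_0_compat; [lra|apply pow_lt; lra]).
assert (H : 0 < (PI * a ^ n) * (2 * p1 * a - (p0 + p2 * a ^ 2))).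
{ replace (PI * a ^ n * (2 * p1 * a - (p0 + p2 * a ^ 2)))
    with (2 * (PI * p1 * a ^ S n) - (PI * p0 * a ^ n + PI * p2 * a ^ S (S n)))
    by (simpl; ring). lra. }
assert (H1 : p0 + p2 * a ^ 2 < 2 * (p1 * a)) by nra.
assert (H2 : (p0 + p2 * a ^ 2) ^ 2 < (2 * (p1 * a)) ^ 2).
{ assert (0 <= p2 * a ^ 2) by (apply Rmult_le_pos; [lra|apply pow_le; lra]). nra. }
assert (H3 : 0 < a ^ 2) by (apply pow_lt; lra).
apply Rmult_lt_reg_r with (4 * a ^ 2); [lra|].
assert (H4 : 0 <= (p0 - p2 * a ^ 2) ^ 2) by apply pow2_ge_0.
nra.
Qed.

(** * Cumulants and bounds for the modulus and the argument *)

Fixpoint sum1 (f : nat -> R) (K : nat) : R :=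
  match K with O => 0 | S k => sum1 f k + f (S k) end.

Lemma sum1_le (f g : nat -> R) (K : nat) :
  (forall k, f (S k) <= g (S k)) -> sum1 f K <= sum1 g K.
Proof. intros H. induction K as [|K IH]; simpl; [lra|]. specialize (H K). lra. Qed.

(** When a partition is drawn with weight proportional to [a] to its size, the multiplicity of the
    part [k] is geometric of ratio [a ^ k]. These three terms are the first three cumulants of [k]
    times that multiplicity. *)
Definition mean_term (a : R) (k : nat) : R := INR k * a ^ k / (1 - a ^ k).
Definition var_term (a : R) (k : nat) : R := INR k ^ 2 * a ^ k / (1 - a ^ k) ^ 2.
Definition third_term (a : R) (k : nat) : R :=
  INR k ^ 3 * (a ^ k * (1 + a ^ k)) / (1 - a ^ k) ^ 3.

Lemma Rinv_sqrt_le (x y e : R) : 0 < x -> 0 < y -> x <= y * exp (2 * e) ->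
  / sqrt y * exp (- e) <= / sqrt x.
Proof.
intros Hx Hy H.
assert (Hsx := sqrt_lt_R0 x Hx). assert (Hsy := sqrt_lt_R0 y Hy).
assert (Hs : sqrt x <= sqrt y * exp e).
{ rewrite <- (sqrt_Rsqr (exp e)) by (left; apply exp_pos).
  rewrite <- sqrt_mult by (lra || apply Rle_0_sqr).
  apply sqrt_le_1_alt. unfold Rsqr. rewrite <- exp_plus.
  now replace (e + e) with (2 * e) by ring. }
rewrite exp_Ropp, <- Rinv_mult. apply Rinv_le_contravar; trivial.
Qed.

Lemma one_minus_cos_le (u : R) : 1 - cos u <= u ^ 2 / 2.
Proof.
destruct (Rle_or_lt 0 u) as [Hu|Hu].
- assert (H := cos_ge_quadratic u Hu). lra.
- assert (H := cos_ge_quadratic (- u)). rewrite cos_neg in H. nra.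
Qed.

(** [rho2 a u / (1 - a)^2] is at most [1 + x] with [x = a u^2 / (1 - a)^2], and [1 + x <= exp x]. *)
Lemma geom_mod_lower (a u : R) : 0 < a < 1 ->
  geom_mod a 0 * exp (- (a / (1 - a) ^ 2 * u ^ 2 / 2)) <= geom_mod a u.
Proof.
intros Ha. apply Rinv_sqrt_le; try (apply rho2_pos; lra).
assert (H0 : 0 < (1 - a) ^ 2) by (apply pow_lt; lra).
set (x := 2 * (a / (1 - a) ^ 2 * u ^ 2 / 2)).
assert (Hx : x * (1 - a) ^ 2 = a * u ^ 2) by (unfold x; field; lra).
assert (Hx0 : 0 <= x).
{ apply Rmult_le_reg_r with ((1 - a) ^ 2); trivial. rewrite Hx, Rmult_0_l.
  apply Rmult_le_pos; [lra|apply pow2_ge_0]. }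
assert (He : 1 + x <= exp x).
{ assert (H := exp_ge_cubic x Hx0). assert (0 <= x ^ 2) by (apply pow_le; lra).
  assert (0 <= x ^ 3) by (apply pow_le; lra). lra. }
unfold rho2. rewrite cos_0. assert (H := one_minus_cos_le u). nra.
Qed.

(** With [v = 4 s], [exp_double_le] gives [exp v <= ((1 + s) / (1 - s))^2], where
    [(1 + s)^2 = (1 - s)^2 + v] and [s <= a]. The range of [v] is that of [2 a (1 - cos u)]. *)
Lemma exp_le_linear (a v : R) : 0 < a < 1 -> 0 <= v <= 4 * a ->
  (1 - a) ^ 2 * exp v <= (1 - a) ^ 2 + v.
Proof.
intros Ha Hv. set (s := v / 4). assert (Hs : 0 <= s <= a) by (unfold s; lra).
assert (H := exp_double_le s ltac:(lra)).
replace v with (2 * s + 2 * s) at 1 by (unfold s; field). rewrite exp_plus.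
assert (H2 : exp (2 * s) * exp (2 * s) <= ((1 + s) / (1 - s)) * ((1 + s) / (1 - s)))
  by (apply Rmult_le_compat; trivial; left; apply exp_pos).
assert (H3 : (1 - s) ^ 2 * ((1 + s) / (1 - s) * ((1 + s) / (1 - s))) = (1 + s) ^ 2)
  by (field; lra).
replace v with (4 * s) by (unfold s; field).
set (E := (1 + s) / (1 - s) * ((1 + s) / (1 - s))) in *.
assert (H1 : 0 < (1 - s) ^ 2) by (apply pow_lt; lra).
assert (H4 : (1 - a) ^ 2 <= (1 - s) ^ 2) by (apply pow_incr; lra).
apply Rle_trans with ((1 - a) ^ 2 * E); [apply Rmult_le_compat_l; trivial; apply pow2_ge_0|].
apply Rmult_le_reg_l with ((1 - s) ^ 2); trivial.
replace ((1 - s) ^ 2 * ((1 - a) ^ 2 * E)) with ((1 - a) ^ 2 * ((1 - s) ^ 2 * E)) by ring.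
rewrite H3. replace ((1 + s) ^ 2) with ((1 - s) ^ 2 + 4 * s) by ring. nra.
Qed.

(** The logarithm of [geom_mod a u / geom_mod a 0] is minus the sum of [a^j (1 - cos (j u)) / j];
    the bound keeps its term [j = 1]. [exp_le_linear] replaces the series. *)
Lemma geom_mod_upper (a u : R) : 0 < a < 1 ->
  geom_mod a u <= geom_mod a 0 * exp (- (a * (1 - cos u))).
Proof.
intros Ha.
assert (H : geom_mod a u * exp (- - (a * (1 - cos u))) <= geom_mod a 0).
{ apply Rinv_sqrt_le; try (apply rho2_pos; lra).
  assert (Hc := COS_bound u). set (v := 2 * (a * (1 - cos u))).
  assert (Hl := exp_le_linear a v Ha ltac:(unfold v; nra)).
  replace (2 * - (a * (1 - cos u))) with (- v) by (unfold v; ring).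
  rewrite exp_Ropp. apply Rmult_le_reg_r with (exp v); [apply exp_pos|].
  rewrite Rmult_assoc, Rinv_l, Rmult_1_r by (apply Rgt_not_eq, exp_pos).
  unfold rho2. rewrite cos_0, Rminus_diag, Rmult_0_r, Rplus_0_r.
  replace (2 * a * (1 - cos u)) with v by (unfold v; ring). exact Hl. }
rewrite Ropp_involutive in H. rewrite exp_Ropp.
apply Rmult_le_reg_r with (exp (a * (1 - cos u))); [apply exp_pos|].
rewrite Rmult_assoc, Rinv_l, Rmult_1_r by (apply Rgt_not_eq, exp_pos). exact H.
Qed.

Lemma gf_mod_lower (a : R) (K : nat) (x : R) : 0 < a < 1 ->
  gf_mod a K 0 * exp (- (sum1 (var_term a) K * x ^ 2 / 2)) <= gf_mod a K x.
Proof.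
intros Ha. induction K as [|K IH].
- simpl. replace (- (0 * (x * (x * 1)) / 2)) with 0 by field. rewrite exp_0. lra.
- cbn [gf_mod sum1]. rewrite Rmult_0_r. assert (HK := pow_in_unit a K Ha).
  replace (- ((sum1 (var_term a) K + var_term a (S K)) * x ^ 2 / 2))
    with (- (sum1 (var_term a) K * x ^ 2 / 2)
          + - (a ^ S K / (1 - a ^ S K) ^ 2 * (INR (S K) * x) ^ 2 / 2))
    by (unfold var_term; field; lra).
  rewrite exp_plus.
  assert (H := geom_mod_lower (a ^ S K) (INR (S K) * x) HK).
  assert (H0 := gf_mod_pos a K 0 Ha).
  assert (H1 : 0 < geom_mod (a ^ S K) 0) by (apply geom_mod_pos; lra).
  match goal with |- context [?g * ?h * (?e1 * ?e2)] =>
    replace (g * h * (e1 * e2)) with ((g * e1) * (h * e2)) by ring end.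
  apply Rmult_le_compat; trivial;
    apply Rmult_le_pos; try (left; assumption); left; apply exp_pos.
Qed.

Lemma gf_mod_upper (a : R) (K : nat) (x : R) : 0 < a < 1 ->
  gf_mod a K x <= gf_mod a K 0 * exp (- sum1 (fun k => a ^ k * (1 - cos (INR k * x))) K).
Proof.
intros Ha. induction K as [|K IH].
- simpl. rewrite Ropp_0, exp_0. lra.
- cbn [gf_mod sum1]. rewrite Rmult_0_r. assert (HK := pow_in_unit a K Ha).
  rewrite Ropp_plus_distr, exp_plus.
  assert (H := geom_mod_upper (a ^ S K) (INR (S K) * x) HK).
  assert (H0 := gf_mod_pos a K x Ha).
  assert (H1 : 0 < geom_mod (a ^ S K) (INR (S K) * x)) by (apply geom_mod_pos; lra).
  match goal with |- context [?g * ?h * (?e1 * ?e2)] =>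
    replace (g * h * (e1 * e2)) with ((g * e1) * (h * e2)) by ring end.
  apply Rmult_le_compat; trivial; left; assumption.
Qed.

(** The derivative is the real part of [z / (1 - z)] at [z = a e^(iu)], written as its value at 0
    minus a nonnegative deficit. Dropping the deficit bounds the argument from above; bounding it by
    a multiple of [u^2] bounds the argument from below. *)
Lemma is_derive_geom_arg (a u : R) : 0 < a < 1 ->
  is_derive (geom_arg a) u (a / (1 - a) - a * (1 + a) * (1 - cos u) / ((1 - a) * rho2 a u)).
Proof.
intros Ha. unfold geom_arg.
assert (Hp := one_minus_mul_cos_pos a u ltac:(lra)).
assert (Hr := rho2_pos a u ltac:(lra)).
auto_derive; [lra|].
assert (E : rho2 a u = (1 - a * cos u) ^ 2 + (a * sin u) ^ 2) by apply rho2_sum_squares.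
assert (Hs : (sin u) ^ 2 = 1 - (cos u) ^ 2).
{ assert (H := sin2_cos2 u). unfold Rsqr in H. simpl. lra. }
set (c := cos u) in *. set (s := sin u) in *.
transitivity ((a * c * (1 - a * c) - a ^ 2 * s ^ 2) / ((1 - a * c) ^ 2 + (a * s) ^ 2)).
{ field. split; [|lra]. rewrite E in Hr.
  replace ((1 - a * c) * (1 - a * c) + a ^ 2 * s ^ 2) with ((1 - a * c) ^ 2 + (a * s) ^ 2) by ring.
  lra. }
rewrite <- E. rewrite Hs.
assert (E2 : rho2 a u = (1 - a) ^ 2 + 2 * a * (1 - c)) by reflexivity.
rewrite E2 in *. field. lra.
Qed.

Lemma geom_arg_0 (a : R) : geom_arg a 0 = 0.
Proof. unfold geom_arg. rewrite sin_0, Rmult_0_r, Rdiv_0_l. apply atan_0. Qed.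

Lemma geom_arg_upper (a u : R) : 0 < a < 1 -> 0 <= u -> geom_arg a u <= a / (1 - a) * u.
Proof.
intros Ha Hu.
assert (H : a / (1 - a) * 0 - geom_arg a 0 <= a / (1 - a) * u - geom_arg a u).
{ apply (derive_nonneg_le (fun u => a / (1 - a) * u - geom_arg a u)
    (fun u => a * (1 + a) * (1 - cos u) / ((1 - a) * rho2 a u))); trivial.
  - intros x Hx.
    replace (a * (1 + a) * (1 - cos x) / ((1 - a) * rho2 a x))
      with (a / (1 - a) - (a / (1 - a) - a * (1 + a) * (1 - cos x) / ((1 - a) * rho2 a x)))
      by ring.
    apply (is_derive_minus (K := R_AbsRing) (V := R_NormedModule)).
    + auto_derive; trivial. ring.
    + now apply is_derive_geom_arg.
  - intros x Hx. assert (Hr := rho2_pos a x ltac:(lra)). assert (Hc := COS_bound x).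
    apply Rdiv_le_0_compat; [|apply Rmult_lt_0_compat; lra].
    apply Rmult_le_pos; [nra|lra]. }
rewrite geom_arg_0 in H. lra.
Qed.

Lemma geom_arg_lower (a u : R) : 0 < a < 1 -> 0 <= u ->
  a / (1 - a) * u - a * (1 + a) / (1 - a) ^ 3 * u ^ 3 / 6 <= geom_arg a u.
Proof.
intros Ha Hu. set (k := a * (1 + a) / (1 - a) ^ 3).
assert (Hk : 0 < k) by (apply Rdiv_lt_0_compat; [nra|apply pow_lt; lra]).
assert (H : geom_arg a 0 - (a / (1 - a) * 0 - k * 0 ^ 3 / 6)
  <= geom_arg a u - (a / (1 - a) * u - k * u ^ 3 / 6)).
{ apply (derive_nonneg_le (fun u => geom_arg a u - (a / (1 - a) * u - k * u ^ 3 / 6))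
    (fun u => (a / (1 - a) - a * (1 + a) * (1 - cos u) / ((1 - a) * rho2 a u))
       - (a / (1 - a) - k * u ^ 2 / 2))); trivial.
  - intros x Hx. apply (is_derive_minus (K := R_AbsRing) (V := R_NormedModule)).
    + now apply is_derive_geom_arg.
    + auto_derive; trivial. field. lra.
  - intros x Hx. assert (Hr := rho2_ge a x ltac:(lra)). assert (Hc := one_minus_cos_le x).
    assert (Hc2 := COS_bound x).
    assert (H0 : 0 < (1 - a) ^ 2) by (apply pow_lt; lra).
    assert (Hle : a * (1 + a) * (1 - cos x) / ((1 - a) * rho2 a x)
      <= a * (1 + a) * (x ^ 2 / 2) / ((1 - a) * (1 - a) ^ 2)).
    { unfold Rdiv at 1 3. apply Rmult_le_compat.
      - apply Rmult_le_pos; [nra|lra].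
      - left. apply Rinv_0_lt_compat, Rmult_lt_0_compat; lra.
      - apply Rmult_le_compat_l; [nra|lra].
      - apply Rinv_le_contravar; [apply Rmult_lt_0_compat; lra|].
        apply Rmult_le_compat_l; lra. }
    replace (k * x ^ 2 / 2) with (a * (1 + a) * (x ^ 2 / 2) / ((1 - a) * (1 - a) ^ 2))
      by (unfold k; field; lra). lra. }
rewrite geom_arg_0 in H. replace (0 ^ 3) with 0 in H by ring. lra.
Qed.

(** At the saddle point the linear term equals [INR N * x], and only the cubic error is left in the
    phase. *)
Lemma gf_arg_bounds (a : R) (K : nat) (x : R) : 0 < a < 1 -> 0 <= x ->
  sum1 (mean_term a) K * x - sum1 (third_term a) K * x ^ 3 / 6 <= gf_arg a K x
  <= sum1 (mean_term a) K * x.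
Proof.
intros Ha Hx. induction K as [|K IH]; [simpl; lra|].
cbn [gf_arg sum1]. assert (HK := pow_in_unit a K Ha).
assert (Hu : 0 <= INR (S K) * x) by (apply Rmult_le_pos; trivial; apply pos_INR).
assert (H1 := geom_arg_lower (a ^ S K) _ HK Hu).
assert (H2 := geom_arg_upper (a ^ S K) _ HK Hu).
assert (E1 : mean_term a (S K) * x = a ^ S K / (1 - a ^ S K) * (INR (S K) * x))
  by (unfold mean_term; field; lra).
assert (E2 : third_term a (S K) * x ^ 3 / 6
  = a ^ S K * (1 + a ^ S K) / (1 - a ^ S K) ^ 3 * (INR (S K) * x) ^ 3 / 6)
  by (unfold third_term; field; lra).
rewrite <- E1, <- E2 in H1. rewrite <- E1 in H2. lra.
Qed.

(** The infinite sum is [a / (1 - a)] minus the real part of [z / (1 - z)], the deficit of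
    [is_derive_geom_arg]; the second term is the tail beyond [K]. *)
Lemma sum_one_minus_cos (a x : R) (K : nat) : 0 < a < 1 ->
  sum1 (fun k => a ^ k * (1 - cos (INR k * x))) K
  = a * (1 + a) * (1 - cos x) / ((1 - a) * rho2 a x)
    - a ^ S K * (/ (1 - a) - (cos (INR (S K) * x) - a * cos (INR K * x)) / rho2 a x).
Proof.
intros Ha. assert (Hr := rho2_pos a x ltac:(lra)).
assert (E : rho2 a x = (1 - a) ^ 2 + 2 * a * (1 - cos x)) by reflexivity.
induction K as [|K IH].
- cbn [sum1]. rewrite pow_1. change (INR 1) with 1. change (INR 0) with 0.
  rewrite Rmult_1_l, Rmult_0_l, cos_0. rewrite E in *. field. lra.
- cbn [sum1]. rewrite IH.
  assert (Hc : cos (INR (S (S K)) * x) = 2 * cos x * cos (INR (S K) * x) - cos (INR K * x)).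
  { replace (INR (S (S K)) * x) with (INR (S K) * x + x) by (rewrite (S_INR (S K)); ring).
    replace (INR K * x) with (INR (S K) * x - x) by (rewrite (S_INR K); ring).
    rewrite cos_plus, cos_minus. ring. }
  rewrite Hc. change (a ^ S (S K)) with (a * a ^ S K).
  set (c1 := cos (INR (S K) * x)). set (c0 := cos (INR K * x)).
  rewrite E in *. field. lra.
Qed.

Lemma sum_one_minus_cos_ge (a x : R) (K : nat) : 0 < a < 1 ->
  a * (1 + a) * (1 - cos x) / ((1 - a) * rho2 a x) - 3 * a ^ S K / (1 - a) ^ 2
  <= sum1 (fun k => a ^ k * (1 - cos (INR k * x))) K.
Proof.
intros Ha. rewrite sum_one_minus_cos by assumption.
assert (Hp : 0 < a ^ S K) by (apply pow_lt; lra).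
assert (H0 : 0 < (1 - a) ^ 2) by (apply pow_lt; lra).
assert (Hr := rho2_ge a x ltac:(lra)).
assert (H1 := COS_bound (INR (S K) * x)). assert (H2 := COS_bound (INR K * x)).
set (c1 := cos (INR (S K) * x)) in *. set (c0 := cos (INR K * x)) in *.
assert (H3 : - (2 / (1 - a) ^ 2) <= (c1 - a * c0) / rho2 a x).
{ apply Rmult_le_reg_r with (rho2 a x); [lra|].
  replace ((c1 - a * c0) / rho2 a x * rho2 a x) with (c1 - a * c0) by (field; lra).
  assert (2 <= 2 / (1 - a) ^ 2 * rho2 a x).
  { replace 2 with (2 / (1 - a) ^ 2 * (1 - a) ^ 2) at 1 by (field; lra).
    apply Rmult_le_compat_l; trivial. left. apply Rdiv_lt_0_compat; lra. }
  assert (- 2 <= c1 - a * c0) by nra. lra. }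
assert (H4 : / (1 - a) <= 1 / (1 - a) ^ 2).
{ replace (1 / (1 - a) ^ 2) with (/ (1 - a) * / (1 - a)) by (field; lra).
  assert (1 <= / (1 - a)) by (rewrite <- Rinv_1 at 1; apply Rinv_le_contravar; lra). nra. }
replace (3 * a ^ S K / (1 - a) ^ 2) with (a ^ S K * (1 / (1 - a) ^ 2 + 2 / (1 - a) ^ 2))
  by (field; lra).
nra.
Qed.

(** * Size of the cumulants *)

(** Here and in the next three lemmas the induction proves the exact value, that is, the infinite
    sum minus a tail which is visibly nonnegative. *)
Lemma sum1_pow_le (c : R) (K : nat) : 0 < c < 1 ->
  sum1 (fun k => c ^ k) K <= c / (1 - c).
Proof.
intros Hc.
assert (E : sum1 (fun k => c ^ k) K = c / (1 - c) - c ^ S K * (1 / (1 - c))).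
{ induction K as [|K IH]; cbn [sum1]; [rewrite pow_1; field; lra|].
  rewrite IH. change (c ^ S (S K)) with (c * c ^ S K). field. lra. }
assert (0 <= c ^ S K * (1 / (1 - c))).
{ apply Rmult_le_pos; [apply pow_le; lra|]. left. apply Rdiv_lt_0_compat; lra. }
lra.
Qed.

Lemma sum1_mul_pow_le (c : R) (K : nat) : 0 < c < 1 ->
  sum1 (fun k => INR k * c ^ k) K <= c / (1 - c) ^ 2.
Proof.
intros Hc.
set (A0 := 1 / (1 - c)). set (A1 := c / (1 - c) ^ 2).
assert (E : sum1 (fun k => INR k * c ^ k) K = A1 - c ^ S K * (INR (S K) * A0 + A1)).
{ unfold A0, A1. induction K as [|K IH]; cbn [sum1].
  - rewrite pow_1. change (INR 1) with 1. field. lra.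
  - rewrite IH. change (c ^ S (S K)) with (c * c ^ S K). rewrite (S_INR (S K)). field. lra. }
assert (0 <= INR (S K)) by apply pos_INR.
assert (0 <= A0) by (left; apply Rdiv_lt_0_compat; lra).
assert (0 <= A1) by (left; apply Rdiv_lt_0_compat; [lra|apply pow_lt; lra]).
assert (0 <= c ^ S K * (INR (S K) * A0 + A1)) by (apply Rmult_le_pos; [apply pow_le; lra|nra]).
lra.
Qed.

Lemma sum1_sqr_pow_le (c : R) (K : nat) : 0 < c < 1 ->
  sum1 (fun k => INR k ^ 2 * c ^ k) K <= c * (1 + c) / (1 - c) ^ 3.
Proof.
intros Hc.
set (A0 := 1 / (1 - c)). set (A1 := c / (1 - c) ^ 2). set (A2 := c * (1 + c) / (1 - c) ^ 3).
assert (E : sum1 (fun k => INR k ^ 2 * c ^ k) K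
  = A2 - c ^ S K * (INR (S K) ^ 2 * A0 + 2 * INR (S K) * A1 + A2)).
{ unfold A0, A1, A2. induction K as [|K IH]; cbn [sum1].
  - rewrite pow_1. change (INR 1) with 1. field. lra.
  - rewrite IH. change (c ^ S (S K)) with (c * c ^ S K). rewrite (S_INR (S K)). field. lra. }
assert (0 <= INR (S K)) by apply pos_INR.
assert (0 <= INR (S K) ^ 2) by (apply pow_le; assumption).
assert (0 <= A0) by (left; apply Rdiv_lt_0_compat; lra).
assert (0 <= A1) by (left; apply Rdiv_lt_0_compat; [lra|apply pow_lt; lra]).
assert (0 <= A2) by (left; apply Rdiv_lt_0_compat; [nra|apply pow_lt; lra]).
assert (0 <= c ^ S K * (INR (S K) ^ 2 * A0 + 2 * INR (S K) * A1 + A2))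
  by (apply Rmult_le_pos; [apply pow_le; lra|nra]).
lra.
Qed.

Lemma sum1_cube_pow_le (c : R) (K : nat) : 0 < c < 1 ->
  sum1 (fun k => INR k ^ 3 * c ^ k) K <= c * (1 + 4 * c + c ^ 2) / (1 - c) ^ 4.
Proof.
intros Hc.
set (A0 := 1 / (1 - c)). set (A1 := c / (1 - c) ^ 2). set (A2 := c * (1 + c) / (1 - c) ^ 3).
set (A3 := c * (1 + 4 * c + c ^ 2) / (1 - c) ^ 4).
assert (E : sum1 (fun k => INR k ^ 3 * c ^ k) K
  = A3 - c ^ S K * (INR (S K) ^ 3 * A0 + 3 * INR (S K) ^ 2 * A1 + 3 * INR (S K) * A2 + A3)).
{ unfold A0, A1, A2, A3. induction K as [|K IH]; cbn [sum1].
  - rewrite pow_1. change (INR 1) with 1. field. lra.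
  - rewrite IH. change (c ^ S (S K)) with (c * c ^ S K). rewrite (S_INR (S K)). field. lra. }
assert (0 <= INR (S K)) by apply pos_INR.
assert (0 <= INR (S K) ^ 2) by (apply pow_le; assumption).
assert (0 <= INR (S K) ^ 3) by (apply pow_le; assumption).
assert (0 <= A0) by (left; apply Rdiv_lt_0_compat; lra).
assert (0 <= A1) by (left; apply Rdiv_lt_0_compat; [lra|apply pow_lt; lra]).
assert (0 <= A2) by (left; apply Rdiv_lt_0_compat; [nra|apply pow_lt; lra]).
assert (0 <= A3) by (left; apply Rdiv_lt_0_compat; [nra|apply pow_lt; lra]).
assert (0 <= c ^ S K * (INR (S K) ^ 3 * A0 + 3 * INR (S K) ^ 2 * A1
                        + 3 * INR (S K) * A2 + A3))
  by (apply Rmult_le_pos; [apply pow_le; lra|nra]).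
lra.
Qed.

Lemma sum1_plus (f g : nat -> R) (K : nat) :
  sum1 (fun k => f k + g k) K = sum1 f K + sum1 g K.
Proof. induction K as [|K IH]; simpl; [ring|]. rewrite IH. ring. Qed.

Lemma sum1_scal (x : R) (f : nat -> R) (K : nat) :
  sum1 (fun k => x * f k) K = x * sum1 f K.
Proof. induction K as [|K IH]; simpl; [ring|]. rewrite IH. ring. Qed.

Lemma pow_pow_comm (b : R) (i k : nat) : (b ^ k) ^ i = (b ^ i) ^ k.
Proof. rewrite <- !pow_mult. f_equal. lia. Qed.

(* [T = 2 sinh (t/2)] when [b ^ 2 = exp (- t)]; it plays the role of [t] while keeping
   every estimate rational in [b]. *)
Definition tilt (b : R) : R := (1 - b ^ 2) / b.

Lemma tilt_pos (b : R) : 0 < b < 1 -> 0 < tilt b.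
Proof. intros Hb. apply Rdiv_lt_0_compat; nra. Qed.

(** Divided by [b ^ k], this is [k * 2 sinh (t/2) <= 2 sinh (k t/2)]. *)
Lemma mul_tilt_le (b : R) (k : nat) : 0 < b < 1 ->
  INR k * (tilt b * b ^ k) <= 1 - (b ^ k) ^ 2.
Proof.
intros Hb. induction k as [|k IH]; [simpl; lra|].
assert (Hq : 0 < b ^ k) by (apply pow_lt; lra).
assert (Hq1 : b ^ k <= 1) by (rewrite <- (pow1 k); apply pow_incr; lra).
rewrite S_INR. change (b ^ S k) with (b * b ^ k).
set (q := b ^ k) in *.
replace ((INR k + 1) * (tilt b * (b * q))) with (b * (INR k * (tilt b * q)) + (1 - b ^ 2) * q)
  by (unfold tilt; field; lra).
assert (H : 0 <= (1 - b) * ((1 - q) * (1 - b * q))) by (repeat apply Rmult_le_pos; nra).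
nra.
Qed.

(* [mean_term], [var_term] and [third_term] are polynomials in [y = b ^ (2k)], [k] and
   [g = k / (1 - y)] (use [k = g * (1 - y)]); bounding [g] by [1 / (T * b ^ k)] in them costs
   little after summation over [k]. *)
Lemma index_ratio_le (b : R) (k : nat) : 0 < b < 1 ->
  let q := b ^ S k in
  0 <= INR (S k) / (1 - q ^ 2) <= 1 / (tilt b * q) /\ 0 < q < 1 /\ 0 < tilt b.
Proof.
intros Hb q. set (T := tilt b). set (n := INR (S k)).
assert (HT : 0 < T) by now apply tilt_pos.
assert (Hq : 0 < q < 1) by now apply pow_in_unit.
assert (Hn : 0 <= n) by apply pos_INR.
assert (H := mul_tilt_le b (S k) Hb). fold T q n in H.
assert (Hd : 0 < 1 - q ^ 2) by nra.
assert (HTq : 0 < T * q) by nra.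
split; [split|split; trivial].
- unfold Rdiv. apply Rmult_le_pos; trivial. left. now apply Rinv_0_lt_compat.
- apply Rmult_le_reg_r with (1 - q ^ 2); trivial.
  apply Rmult_le_reg_r with (T * q); trivial.
  replace (n / (1 - q ^ 2) * (1 - q ^ 2) * (T * q)) with (n * (T * q)) by (field; lra).
  replace (1 / (T * q) * (1 - q ^ 2) * (T * q)) with (1 - q ^ 2) by (field; lra).
  exact H.
Qed.

Lemma mean_term_le (b : R) (k : nat) : 0 < b < 1 ->
  let T := tilt b in let n := INR (S k) in
  mean_term (b ^ 2) (S k) <= n * (b ^ 2) ^ S k + / T * (b ^ 3) ^ S k.
Proof.
intros Hb T n. destruct (index_ratio_le b k Hb) as [Hg [Hq HT]].
set (q := b ^ S k) in *. fold T n in Hg, HT. unfold mean_term.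
rewrite <- !(pow_pow_comm b _ (S k)). fold q n.
set (g := n / (1 - q ^ 2)) in *.
assert (Hd : 0 < 1 - q ^ 2) by nra.
replace (n * q ^ 2 / (1 - q ^ 2)) with (n * q ^ 2 + q ^ 4 * g) by (unfold g; field; lra).
replace (/ T * q ^ 3) with (q ^ 4 * (1 / (T * q))) by (field; lra).
assert (0 <= q ^ 4) by (apply pow_le; lra). nra.
Qed.

Lemma var_term_le (b : R) (k : nat) : 0 < b < 1 ->
  let T := tilt b in let n := INR (S k) in
  var_term (b ^ 2) (S k)
  <= n ^ 2 * (b ^ 2) ^ S k + (2 / T * (n * (b ^ 3) ^ S k) + / T ^ 2 * (b ^ 4) ^ S k).
Proof.
intros Hb T n. destruct (index_ratio_le b k Hb) as [Hg [Hq HT]].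
set (q := b ^ S k) in *. fold T n in Hg, HT. unfold var_term.
rewrite <- !(pow_pow_comm b _ (S k)). fold q n.
assert (Hn : 0 <= n) by apply pos_INR.
set (g := n / (1 - q ^ 2)) in *. set (h := 1 / (T * q)) in *.
assert (Hd : 0 < 1 - q ^ 2) by nra.
replace (n ^ 2 * q ^ 2 / (1 - q ^ 2) ^ 2)
  with (n ^ 2 * q ^ 2 + (2 * n * q ^ 4 * g + q ^ 6 * g ^ 2)) by (unfold g; field; lra).
replace (2 / T * (n * q ^ 3)) with (2 * n * q ^ 4 * h) by (unfold h; field; lra).
replace (/ T ^ 2 * q ^ 4) with (q ^ 6 * h ^ 2) by (unfold h; field; lra).
assert (0 <= q ^ 4) by (apply pow_le; lra). assert (0 <= q ^ 6) by (apply pow_le; lra).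
assert (g ^ 2 <= h ^ 2) by (apply pow_incr; lra).
assert (0 <= 2 * n * q ^ 4) by (apply Rmult_le_pos; lra).
apply Rplus_le_compat_l, Rplus_le_compat; apply Rmult_le_compat_l; lra.
Qed.

Lemma third_term_le (b : R) (k : nat) : 0 < b < 1 ->
  let T := tilt b in let n := INR (S k) in
  third_term (b ^ 2) (S k)
  <= n ^ 3 * (b ^ 2) ^ S k + (4 / T * (n ^ 2 * (b ^ 3) ^ S k)
     + (5 / T ^ 2 * (n * (b ^ 4) ^ S k) + 2 / T ^ 3 * (b ^ 5) ^ S k)).
Proof.
intros Hb T n. destruct (index_ratio_le b k Hb) as [Hg [Hq HT]].
set (q := b ^ S k) in *. fold T n in Hg, HT. unfold third_term.
rewrite <- !(pow_pow_comm b _ (S k)). fold q n.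
assert (Hn : 0 <= n) by apply pos_INR.
set (g := n / (1 - q ^ 2)) in *. set (h := 1 / (T * q)) in *.
assert (Hd : 0 < 1 - q ^ 2) by nra.
replace (n ^ 3 * (q ^ 2 * (1 + q ^ 2)) / (1 - q ^ 2) ^ 3)
  with (n ^ 3 * q ^ 2 + (4 * n ^ 2 * q ^ 4 * g + (5 * n * q ^ 6 * g ^ 2 + 2 * q ^ 8 * g ^ 3)))
  by (unfold g; field; lra).
replace (4 / T * (n ^ 2 * q ^ 3)) with (4 * n ^ 2 * q ^ 4 * h) by (unfold h; field; lra).
replace (5 / T ^ 2 * (n * q ^ 4)) with (5 * n * q ^ 6 * h ^ 2) by (unfold h; field; lra).
replace (2 / T ^ 3 * q ^ 5) with (2 * q ^ 8 * h ^ 3) by (unfold h; field; lra).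
assert (0 <= q ^ 4) by (apply pow_le; lra). assert (0 <= q ^ 6) by (apply pow_le; lra).
assert (0 <= q ^ 8) by (apply pow_le; lra). assert (0 <= n ^ 2) by (apply pow_le; lra).
assert (g ^ 2 <= h ^ 2) by (apply pow_incr; lra).
assert (g ^ 3 <= h ^ 3) by (apply pow_incr; lra).
assert (0 <= 4 * n ^ 2 * q ^ 4) by (apply Rmult_le_pos; lra).
assert (0 <= 5 * n * q ^ 6) by (apply Rmult_le_pos; lra).
apply Rplus_le_compat_l, Rplus_le_compat; [|apply Rplus_le_compat];
  apply Rmult_le_compat_l; lra.
Qed.

Lemma Rdiv_le_of_mul (x y z w : R) : 0 < y -> 0 < w -> x * w <= z * y -> x / y <= z / w.
Proof.
intros Hy Hw H. apply Rmult_le_reg_r with (y * w); [nra|].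
replace (x / y * (y * w)) with (x * w) by (field; lra).
replace (z / w * (y * w)) with (z * y) by (field; lra). exact H.
Qed.

(** The main sum is at most [1 / T^2] and the correction adds [2/3]. For large [K] and small [T] the
    true constant is [pi^2 / 6], about 1.645. *)
Lemma mean_le (b : R) (K : nat) : 0 < b < 1 ->
  sum1 (mean_term (b ^ 2)) K <= 5 / 3 / tilt b ^ 2.
Proof.
intros Hb. set (T := tilt b). assert (HT : 0 < T) by now apply tilt_pos.
assert (Hb2 := pow_in_unit b 1 Hb). assert (Hb3 := pow_in_unit b 2 Hb).
eapply Rle_trans.
{ apply (sum1_le _ (fun k => INR k * (b ^ 2) ^ k + / T * (b ^ 3) ^ k)).
  intros k. now apply mean_term_le. }
rewrite sum1_plus, sum1_scal.
assert (H1 := sum1_mul_pow_le (b ^ 2) K Hb2).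
assert (H2 := sum1_pow_le (b ^ 3) K Hb3).
replace (b ^ 2 / (1 - b ^ 2) ^ 2) with (1 / T ^ 2) in H1
  by (unfold T, tilt; field; repeat split; lra).
assert (H3 : b ^ 3 / (1 - b ^ 3) <= 2 / (3 * T)).
{ apply Rdiv_le_of_mul; [lra|lra|].
  replace (b ^ 3 * (3 * T)) with (3 * (b ^ 2 * (1 - b ^ 2))) by (unfold T, tilt; field; lra).
  assert (0 <= (1 - b) * (2 + 2 * b - b ^ 2 - 3 * b ^ 3)) by (apply Rmult_le_pos; nra).
  nra. }
assert (HTi : 0 < / T) by now apply Rinv_0_lt_compat.
replace (5 / 3 / T ^ 2) with (1 / T ^ 2 + / T * (2 / (3 * T))) by (field; lra).
apply Rplus_le_compat; [exact H1|].
apply Rmult_le_compat_l; [lra|exact (Rle_trans _ _ _ H2 H3)].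
Qed.

Lemma tilt_small (b : R) : 0 < b < 1 -> tilt b <= 3 / 100 -> 98 / 100 <= b.
Proof.
intros Hb H. unfold tilt in H.
assert (1 - b ^ 2 <= 3 / 100 * b); [|nra].
replace (1 - b ^ 2) with ((1 - b ^ 2) / b * b) by (field; lra). nra.
Qed.

(** The constant is [2 + 8/9 + 1/2] plus a small error; the limiting value is [pi^2 / 3], about
    3.29. *)
Lemma var_le (b : R) (K : nat) : 0 < b < 1 -> tilt b <= 3 / 100 ->
  sum1 (var_term (b ^ 2)) K <= 339 / 100 / tilt b ^ 3.
Proof.
intros Hb HTs. set (T := tilt b) in *. assert (HT : 0 < T) by now apply tilt_pos.
assert (Hb2 := pow_in_unit b 1 Hb). assert (Hb3 := pow_in_unit b 2 Hb).
assert (Hb4 := pow_in_unit b 3 Hb).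
assert (ET : T * b = 1 - b ^ 2) by (unfold T, tilt; field; lra).
eapply Rle_trans.
{ apply (sum1_le _ (fun k => INR k ^ 2 * (b ^ 2) ^ k
    + (2 / T * (INR k * (b ^ 3) ^ k) + / T ^ 2 * (b ^ 4) ^ k))).
  intros k. now apply var_term_le. }
rewrite !sum1_plus, !sum1_scal.
assert (H1 := sum1_sqr_pow_le (b ^ 2) K Hb2).
assert (H2 := sum1_mul_pow_le (b ^ 3) K Hb3).
assert (H3 := sum1_pow_le (b ^ 4) K Hb4).
assert (HT3 : 0 < T ^ 3) by (apply pow_lt; lra).
(* [(1 + b^2) / b] is the square root of [4 + T^2], hence at most [2 + T^2 / 4]. *)
assert (H1' : b ^ 2 * (1 + b ^ 2) / (1 - b ^ 2) ^ 3 <= (2 + T ^ 2 / 4) / T ^ 3).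
{ replace (b ^ 2 * (1 + b ^ 2) / (1 - b ^ 2) ^ 3) with (((1 + b ^ 2) / b) / T ^ 3)
    by (unfold T, tilt; field; repeat split; lra).
  unfold Rdiv at 1 3. apply Rmult_le_compat_r; [left; now apply Rinv_0_lt_compat|].
  replace (T ^ 2) with ((1 - b ^ 2) ^ 2 / b ^ 2) by (unfold T, tilt; field; lra).
  apply Rmult_le_reg_r with (4 * b ^ 2); [nra|].
  replace ((1 + b ^ 2) / b * (4 * b ^ 2)) with (4 * b * (1 + b ^ 2)) by (field; lra).
  replace ((2 + (1 - b ^ 2) ^ 2 / b ^ 2 / 4) * (4 * b ^ 2))
    with (8 * b ^ 2 + (1 - b ^ 2) ^ 2) by (field; lra).
  assert (0 <= ((1 - b) ^ 2) ^ 2) by apply pow2_ge_0. nra. }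
assert (H2' : b ^ 3 / (1 - b ^ 3) ^ 2 <= 4 / (9 * T ^ 2)).
{ apply Rdiv_le_of_mul; [apply pow_lt; lra|assert (0 < T ^ 2) by (apply pow_lt; lra); lra|].
  replace (b ^ 3 * (9 * T ^ 2)) with (9 * b * (T * b) ^ 2) by ring. rewrite ET.
  assert (0 <= (1 - b) ^ 2 * ((1 - b) ^ 2 * (4 * b ^ 2 + 7 * b + 4)))
    by (repeat apply Rmult_le_pos; nra).
  nra. }
assert (H3' : b ^ 4 / (1 - b ^ 4) <= 1 / (2 * T)).
{ apply Rdiv_le_of_mul; [lra|lra|].
  replace (b ^ 4 * (2 * T)) with (2 * b ^ 3 * (T * b)) by ring. rewrite ET.
  replace (1 * (1 - b ^ 4)) with ((1 + b ^ 2) * (1 - b ^ 2)) by ring.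
  apply Rmult_le_compat_r; [lra|nra]. }
assert (T ^ 2 <= 9 / 10000) by nra.
assert (HTi : 0 < 2 / T) by (apply Rdiv_lt_0_compat; lra).
assert (HTi2 : 0 < / T ^ 2) by (apply Rinv_0_lt_compat, pow_lt; lra).
apply Rle_trans with
  ((2 + T ^ 2 / 4) / T ^ 3 + (2 / T * (4 / (9 * T ^ 2)) + / T ^ 2 * (1 / (2 * T)))).
{ apply Rplus_le_compat; [exact (Rle_trans _ _ _ H1 H1')|].
  apply Rplus_le_compat; (apply Rmult_le_compat_l; [lra|eapply Rle_trans; eassumption]). }
replace ((2 + T ^ 2 / 4) / T ^ 3 + (2 / T * (4 / (9 * T ^ 2)) + / T ^ 2 * (1 / (2 * T))))
  with ((2 + T ^ 2 / 4 + 8 / 9 + 1 / 2) / T ^ 3) by (field; lra).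
unfold Rdiv at 1 5. apply Rmult_le_compat_r; [left; now apply Rinv_0_lt_compat|]. lra.
Qed.

(** The constant is [6 + 2.4 + 1.25 + 0.8] plus a small error; the limiting value is [pi^2]. *)
Lemma third_le (b : R) (K : nat) : 0 < b < 1 -> tilt b <= 3 / 100 ->
  sum1 (third_term (b ^ 2)) K <= 1046 / 100 / tilt b ^ 4.
Proof.
intros Hb HTs. assert (Hbl := tilt_small b Hb HTs).
set (T := tilt b) in *. assert (HT : 0 < T) by now apply tilt_pos.
assert (Hb2 := pow_in_unit b 1 Hb). assert (Hb3 := pow_in_unit b 2 Hb).
assert (Hb4 := pow_in_unit b 3 Hb). assert (Hb5 := pow_in_unit b 4 Hb).
assert (ET : T * b = 1 - b ^ 2) by (unfold T, tilt; field; lra).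
eapply Rle_trans.
{ apply (sum1_le _ (fun k => INR k ^ 3 * (b ^ 2) ^ k
    + (4 / T * (INR k ^ 2 * (b ^ 3) ^ k)
    + (5 / T ^ 2 * (INR k * (b ^ 4) ^ k) + 2 / T ^ 3 * (b ^ 5) ^ k)))).
  intros k. now apply third_term_le. }
rewrite !sum1_plus, !sum1_scal.
assert (H1 := sum1_cube_pow_le (b ^ 2) K Hb2).
assert (H2 := sum1_sqr_pow_le (b ^ 3) K Hb3).
assert (H3 := sum1_mul_pow_le (b ^ 4) K Hb4).
assert (H4 := sum1_pow_le (b ^ 5) K Hb5).
assert (HT2 : 0 < T ^ 2) by (apply pow_lt; lra).
assert (HT3 : 0 < T ^ 3) by (apply pow_lt; lra).
assert (HT4 : 0 < T ^ 4) by (apply pow_lt; lra).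
replace (b ^ 2 * (1 + 4 * b ^ 2 + (b ^ 2) ^ 2) / (1 - b ^ 2) ^ 4) with ((6 + T ^ 2) / T ^ 4) in H1
  by (unfold T, tilt; field; repeat split; lra).
assert (H2' : b ^ 3 * (1 + b ^ 3) / (1 - b ^ 3) ^ 3 <= (6 / 10) / T ^ 3).
{ apply Rdiv_le_of_mul; [apply pow_lt; lra|lra|].
  replace (b ^ 3 * (1 + b ^ 3) * T ^ 3) with ((1 + b ^ 3) * (T * b) ^ 3) by ring. rewrite ET.
  replace ((1 + b ^ 3) * (1 - b ^ 2) ^ 3) with ((1 - b) ^ 3 * ((1 + b ^ 3) * (1 + b) ^ 3)) by ring.
  replace (6 / 10 * (1 - b ^ 3) ^ 3) with ((1 - b) ^ 3 * (6 / 10 * (1 + b + b ^ 2) ^ 3)) by ring.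
  apply Rmult_le_compat_l; [apply pow_le; lra|].
  (* At [b = 1] the two sides are 16 and 16.2, so closeness to 1 is enough. *)
  set (e := 1 - b). replace b with (1 - e) by (unfold e; ring).
  assert (He : 0 <= e <= 2 / 100) by (unfold e; lra).
  clearbody e. nra. }
assert (H3' : b ^ 4 / (1 - b ^ 4) ^ 2 <= 1 / (4 * T ^ 2)).
{ apply Rdiv_le_of_mul; [apply pow_lt; lra|lra|].
  replace (b ^ 4 * (4 * T ^ 2)) with ((2 * b) ^ 2 * (T * b) ^ 2) by ring. rewrite ET.
  replace (1 * (1 - b ^ 4) ^ 2) with ((1 + b ^ 2) ^ 2 * (1 - b ^ 2) ^ 2) by ring.
  apply Rmult_le_compat_r; [apply pow2_ge_0|]. apply pow_incr. nra. }
assert (H4' : b ^ 5 / (1 - b ^ 5) <= 2 / (5 * T)).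
{ apply Rdiv_le_of_mul; [lra|lra|].
  replace (b ^ 5 * (5 * T)) with (5 * b ^ 4 * (T * b)) by ring. rewrite ET.
  replace (5 * b ^ 4 * (1 - b ^ 2)) with ((1 - b) * (5 * b ^ 4 * (1 + b))) by ring.
  replace (2 * (1 - b ^ 5)) with ((1 - b) * (2 * (1 + b + b ^ 2 + b ^ 3 + b ^ 4))) by ring.
  apply Rmult_le_compat_l; [lra|].
  assert (b ^ 4 <= b ^ 3) by (simpl in *; nra).
  assert (b ^ 3 <= b ^ 2) by nra. assert (b ^ 2 <= b) by nra.
  assert (b * b ^ 4 <= b ^ 4) by nra. lra. }
assert (T ^ 2 <= 9 / 10000) by nra.
assert (HTi : 0 < 4 / T) by (apply Rdiv_lt_0_compat; lra).
assert (HTi2 : 0 < 5 / T ^ 2) by (apply Rdiv_lt_0_compat; lra).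
assert (HTi3 : 0 < 2 / T ^ 3) by (apply Rdiv_lt_0_compat; lra).
apply Rle_trans with ((6 + T ^ 2) / T ^ 4 + (4 / T * (6 / 10 / T ^ 3)
  + (5 / T ^ 2 * (1 / (4 * T ^ 2)) + 2 / T ^ 3 * (2 / (5 * T))))).
{ apply Rplus_le_compat; [exact H1|].
  apply Rplus_le_compat; [|apply Rplus_le_compat];
    (apply Rmult_le_compat_l; [lra|eapply Rle_trans; eassumption]). }
replace ((6 + T ^ 2) / T ^ 4 + (4 / T * (6 / 10 / T ^ 3)
  + (5 / T ^ 2 * (1 / (4 * T ^ 2)) + 2 / T ^ 3 * (2 / (5 * T)))))
  with ((6 + T ^ 2 + 24 / 10 + 5 / 4 + 8 / 10) / T ^ 4) by (field; lra).
unfold Rdiv at 1 5. apply Rmult_le_compat_r; [left; now apply Rinv_0_lt_compat|]. lra.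
Qed.

(** * Positivity of the Fourier integral *)

Definition second_diff_integrand (a : R) (K N : nat) (x : R) : R :=
  gf_mod a K x * cos (gf_arg a K x - INR N * x) * (1 - cos x).

Lemma continuous_second_diff_integrand (a : R) (K N : nat) (x : R) : 0 < a < 1 ->
  continuous (second_diff_integrand a K N) x.
Proof.
intros Ha. apply (continuous_mult (K := R_AbsRing)); [now apply continuous_twisted_gf|].
apply (continuous_minus (V := R_NormedModule)); [apply continuous_const|].
apply continuity_pt_filterlim, continuity_cos.
Qed.

Lemma RInt_ge_scaled (f Q dQ : R -> R) (s u v : R) :
  0 < s -> u <= v ->
  (forall x, continuous f x) ->
  (forall y, u <= y <= v -> is_derive Q y (dQ y)) ->
  (forall y, u <= y <= v -> dQ y <= f (s * y)) ->
  s * (Q v - Q u) <= RInt f (s * u) (s * v).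
Proof.
intros Hs Huv Hc Hd Hle.
assert (Hy : forall x, s * u <= x <= s * v -> u <= x / s <= v).
{ intros x Hx. split; (apply Rmult_le_reg_l with s; trivial);
    replace (s * (x / s)) with x by (field; lra); lra. }
assert (H : s * Q (s * v / s) - s * Q (s * u / s) <= RInt f (s * u) (s * v)).
{ apply (RInt_ge_antiderivative f (fun x => s * Q (x / s)) (fun x => dQ (x / s))); trivial.
  - nra.
  - intros x Hx. specialize (Hd _ (Hy x Hx)).
    replace (dQ (x / s)) with (s * (/ s * dQ (x / s))) by (field; lra).
    apply is_derive_scal.
    apply (is_derive_comp (V := R_NormedModule) Q (fun x => x / s)); trivial.
    auto_derive; trivial. field. lra.
  - intros x Hx. specialize (Hle _ (Hy x Hx)).
    now replace (s * (x / s)) with x in Hle by (field; lra). }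
replace (s * v / s) with v in H by (field; lra).
replace (s * u / s) with u in H by (field; lra). lra.
Qed.

Lemma exp_neg_le (x c : R) (m : nat) : 0 <= x -> 0 < c -> (0 < m)%nat ->
  1 <= c * (1 + x / INR m + (x / INR m) ^ 2 / 2 + (x / INR m) ^ 3 / 6) ^ m ->
  exp (- x) <= c.
Proof.
intros Hx Hc Hm H. set (y := x / INR m) in *.
assert (HM : 0 < INR m) by now apply lt_0_INR.
assert (Hy : 0 <= y) by (apply Rdiv_le_0_compat; trivial).
assert (Hp := exp_ge_cubic y Hy).
assert (0 <= y ^ 2) by (apply pow_le; lra). assert (0 <= y ^ 3) by (apply pow_le; lra).
assert (He : (1 + y + y ^ 2 / 2 + y ^ 3 / 6) ^ m <= exp x).
{ replace x with (INR m * y) by (unfold y; field; lra). rewrite <- exp_pow.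
  apply pow_incr. lra. }
rewrite exp_Ropp. assert (E := exp_pos x).
apply Rmult_le_reg_r with (exp x); trivial. rewrite Rinv_l by lra.
apply Rle_trans with (1 := H). apply Rmult_le_compat_l; lra.
Qed.

Lemma exp_neg_ge (x : R) (m : nat) : x <= INR m -> (0 < m)%nat -> (1 - x / INR m) ^ m <= exp (- x).
Proof.
intros Hx Hm. assert (HM : 0 < INR m) by now apply lt_0_INR.
replace (- x) with (INR m * (- (x / INR m))) by (field; lra).
rewrite <- exp_pow. apply pow_incr. split.
- assert (x / INR m <= 1); [|lra]. apply Rmult_le_reg_r with (INR m); trivial.
  replace (x / INR m * INR m) with x by (field; lra). lra.
- assert (H := exp_ineq1_le (- (x / INR m))). lra.
Qed.

Lemma one_minus_cos_ge (x : R) : 0 <= x -> x ^ 2 * (1 - x ^ 2 / 12) <= 2 * (1 - cos x).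
Proof. intros Hx. assert (H := cos_le_quartic x Hx). lra. Qed.

Lemma Rdiv_add_mono (t v w : R) : 0 < t -> 0 <= v <= w -> v / (t + v) <= w / (t + w).
Proof. intros Ht Hv. apply Rdiv_le_of_mul; nra. Qed.

(** In terms of [T] and [v = 2 (1 - cos x)], the main term of [sum_one_minus_cos_ge] is
    [v / (T^2 + v) / T] times [(1 + b^2) / (2 b) >= 1], which is dropped. The factor [101 / 100]
    pays for the tail, as it exceeds [exp (1 / 200)]. *)
Lemma gf_mod_decay (b : R) (K : nat) (x : R) : 0 < b < 1 ->
  3 * (b ^ 2) ^ S K / (1 - b ^ 2) ^ 2 <= 1 / 200 ->
  gf_mod (b ^ 2) K x <= gf_mod (b ^ 2) K 0 * (101 / 100)
    * exp (- (2 * (1 - cos x) / (tilt b ^ 2 + 2 * (1 - cos x)) / tilt b)).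
Proof.
intros Hb HK. set (T := tilt b). assert (HT : 0 < T) by now apply tilt_pos.
assert (Hb2 := pow_in_unit b 1 Hb). assert (Hc := COS_bound x).
assert (HT2 : 0 < T ^ 2) by (apply pow_lt; lra).
set (v := 2 * (1 - cos x)).
assert (H := gf_mod_upper (b ^ 2) K x Hb2).
assert (HS := sum_one_minus_cos_ge (b ^ 2) x K Hb2).
set (S0 := sum1 _ K) in *.
assert (HE : v / (T ^ 2 + v) / T
  <= b ^ 2 * (1 + b ^ 2) * (1 - cos x) / ((1 - b ^ 2) * rho2 (b ^ 2) x)).
{ assert (Er : rho2 (b ^ 2) x = b ^ 2 * (T ^ 2 + v)).
  { unfold rho2, v, T, tilt. field. lra. }
  assert (Hv : 0 <= v) by (unfold v; lra). rewrite Er.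
  replace (1 - b ^ 2) with (T * b) by (unfold T, tilt; field; lra).
  replace (b ^ 2 * (1 + b ^ 2) * (1 - cos x) / (T * b * (b ^ 2 * (T ^ 2 + v))))
    with ((1 + b ^ 2) / (2 * b) * (v / (T ^ 2 + v) / T)) by (unfold v; field; lra).
  assert (1 <= (1 + b ^ 2) / (2 * b)).
  { apply Rmult_le_reg_r with (2 * b); [lra|].
    replace ((1 + b ^ 2) / (2 * b) * (2 * b)) with (1 + b ^ 2) by (field; lra). nra. }
  assert (0 <= v / (T ^ 2 + v) / T)
    by (apply Rdiv_le_0_compat; trivial; apply Rdiv_le_0_compat; lra).
  nra. }
apply Rle_trans with (1 := H). rewrite Rmult_assoc.
apply Rmult_le_compat_l; [left; now apply gf_mod_pos|].
assert (He : exp (1 / 200) <= 101 / 100).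
{ replace (1 / 200) with (2 * (1 / 400)) by field.
  eapply Rle_trans; [apply exp_double_le; lra|lra]. }
apply Rle_trans with (exp (1 / 200) * exp (- (v / (T ^ 2 + v) / T))).
- rewrite <- exp_plus.
  destruct (Req_dec (- S0) (1 / 200 + - (v / (T ^ 2 + v) / T))) as [->|]; [lra|].
  left. apply exp_increasing. lra.
- apply Rmult_le_compat_r; [left; apply exp_pos|exact He].
Qed.

(* An antiderivative of [y^2 (1 - 0.212 y^2)^8 (1 - 0.0456 y^6)], where the last two factors
   bound the Gaussian [exp (-1.696 y^2)] and the cosine of the phase from below. *)
Definition main_poly (y : R) : R :=
  (1 / 3) * y ^ 3
  - (212 / 625) * y ^ 5
  + (2809 / 15625) * y ^ 7
  - (2262403 / 35156250) * y ^ 9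
  + (85443367 / 4296875000) * y ^ 11
  - (9932312201 / 1586914062500) * y ^ 13
  + (1640198602903 / 915527343750000) * y ^ 15
  - (12591732156053 / 32424926757812500) * y ^ 17
  + (16748259861111361 / 289916992187500000000) * y ^ 19
  - (421122861451 / 76293945312500000) * y ^ 21
  + (66958534970709 / 219345092773437500000) * y ^ 23
  - (3548802353447577 / 476837158203125000000000) * y ^ 25.

Lemma is_derive_main_poly (y : R) :
  is_derive main_poly y
    (y ^ 2 * (1 - 212 / 1000 * y ^ 2) ^ 8 * (1 - 456 / 10000 * y ^ 6)).
Proof. unfold main_poly. auto_derive; trivial. field. Qed.

Lemma main_poly_value : 154 / 1000 <= main_poly (167 / 100) - main_poly 0.
Proof. unfold main_poly. lra. Qed.

(* [s = T ^ (3/2)] is, up to a constant, the inverse of the standard deviation. *)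
Lemma main_arc (b : R) (K N : nat) : 0 < b < 1 -> tilt b <= 3 / 100 ->
  sum1 (mean_term (b ^ 2)) K = INR N ->
  let s := tilt b * sqrt (tilt b) in
  gf_mod (b ^ 2) K 0 * s ^ 3 / 2 * (153 / 1000)
  <= RInt (second_diff_integrand (b ^ 2) K N) (s * 0) (s * (167 / 100)).
Proof.
intros Hb HTs Hm s. set (T := tilt b) in *. assert (HT : 0 < T) by now apply tilt_pos.
assert (Hb2 := pow_in_unit b 1 Hb).
assert (Hr : 0 < sqrt T) by now apply sqrt_lt_R0.
assert (Hrr : sqrt T ^ 2 = T) by (simpl; rewrite Rmult_1_r; apply sqrt_sqrt; lra).
assert (Hs : 0 < s) by now apply Rmult_lt_0_compat.
assert (Hs2 : s ^ 2 = T ^ 3) by (unfold s; rewrite Rpow_mult_distr, Hrr; ring).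
assert (HT3 : T ^ 3 <= 27 / 1000000).
{ apply Rle_trans with ((3 / 100) ^ 3); [apply pow_incr; lra|lra]. }
set (W0 := gf_mod (b ^ 2) K 0). assert (HW0 : 0 < W0) by now apply gf_mod_pos.
assert (HT3p : 0 < T ^ 3) by (apply pow_lt; lra).
apply Rle_trans with (s * (W0 * (s ^ 2 / 2) * (9999 / 10000) * main_poly (167 / 100)
  - W0 * (s ^ 2 / 2) * (9999 / 10000) * main_poly 0)).
{ assert (H := main_poly_value).
  replace (W0 * s ^ 3 / 2 * (153 / 1000)) with (s * (W0 * (s ^ 2 / 2) * (153 / 1000))) by field.
  apply Rmult_le_compat_l; [lra|].
  assert (0 < W0 * (s ^ 2 / 2)) by (apply Rmult_lt_0_compat; lra). nra. }
apply (RInt_ge_scaled _ (fun y => W0 * (s ^ 2 / 2) * (9999 / 10000) * main_poly y)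
  (fun y => W0 * (s ^ 2 / 2) * (9999 / 10000)
     * (y ^ 2 * (1 - 212 / 1000 * y ^ 2) ^ 8 * (1 - 456 / 10000 * y ^ 6)))); trivial.
- lra.
- intros x. now apply continuous_second_diff_integrand.
- intros y _. apply is_derive_scal, is_derive_main_poly.
- intros y Hy. set (x := s * y).
  assert (Hx : 0 <= x) by (apply Rmult_le_pos; lra).
  assert (Hy2 : 0 <= y ^ 2 <= 28 / 10) by nra.
  assert (Hx2 : x ^ 2 = T ^ 3 * y ^ 2) by (unfold x; rewrite Rpow_mult_distr, Hs2; ring).
  assert (Hx2b : x ^ 2 <= 1 / 10000).
  { rewrite Hx2. apply Rle_trans with (27 / 1000000 * (28 / 10)); [|lra].
    apply Rmult_le_compat; lra. }
  unfold second_diff_integrand.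
  assert (G : W0 * (1 - 212 / 1000 * y ^ 2) ^ 8 <= gf_mod (b ^ 2) K x).
  { apply Rle_trans with (2 := gf_mod_lower (b ^ 2) K x Hb2).
    apply Rmult_le_compat_l; [now left|].
    (* 1.696 is [8 * 0.212], just above half of the constant 3.39 of [var_le]. *)
    apply Rle_trans with (exp (- (1696 / 1000 * y ^ 2))).
    - replace (1 - 212 / 1000 * y ^ 2) with (1 - (1696 / 1000 * y ^ 2) / INR 8)
        by (simpl; field).
      apply exp_neg_ge; [simpl; lra|lia].
    - assert (Hv := var_le b K Hb HTs). fold T in Hv.
      set (V := sum1 (var_term (b ^ 2)) K) in *.
      assert (V * T ^ 3 <= 339 / 100).
      { replace (339 / 100) with (339 / 100 / T ^ 3 * T ^ 3) by (field; lra).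
        apply Rmult_le_compat_r; lra. }
      assert (V * x ^ 2 / 2 <= 1696 / 1000 * y ^ 2) by (rewrite Hx2; nra).
      destruct (Req_dec (- (1696 / 1000 * y ^ 2)) (- (V * x ^ 2 / 2))) as [->|]; [lra|].
      left. apply exp_increasing. lra. }
  assert (A : 1 - 456 / 10000 * y ^ 6 <= cos (gf_arg (b ^ 2) K x - INR N * x)).
  { assert (Hb1 := gf_arg_bounds (b ^ 2) K x Hb2 Hx). rewrite Hm in Hb1.
    set (al := gf_arg (b ^ 2) K x - INR N * x).
    assert (Hk := third_le b K Hb HTs). fold T in Hk.
    set (V := sum1 (third_term (b ^ 2)) K) in *.
    assert (HT4 : 0 < T ^ 4) by (apply pow_lt; lra).
    assert (HV : V * T ^ 4 <= 1046 / 100).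
    { replace (1046 / 100) with (1046 / 100 / T ^ 4 * T ^ 4) by (field; lra).
      apply Rmult_le_compat_r; lra. }
    assert (Hx3 : x ^ 3 = T ^ 4 * (sqrt T * y ^ 3)).
    { unfold x, s.
      replace ((T * sqrt T * y) ^ 3) with (T ^ 3 * sqrt T ^ 2 * (sqrt T * y ^ 3)) by ring.
      rewrite Hrr. ring. }
    set (z := sqrt T * y ^ 3) in *.
    assert (Hz : 0 <= z) by (apply Rmult_le_pos; [lra|apply pow_le; lra]).
    (* Since [z^2 = T y^6] and [T <= 0.03], half the square of this bound is below [0.0456 y^6]. *)
    assert (Hal : 0 <= - al <= 1046 / 600 * z).
    { unfold al. assert (V * x ^ 3 / 6 <= 1046 / 600 * z) by (rewrite Hx3; nra). lra. }
    rewrite <- cos_neg. apply Rle_trans with (2 := cos_ge_quadratic (- al) (proj1 Hal)).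
    assert (Hz2 : z ^ 2 = T * y ^ 6) by (unfold z; rewrite Rpow_mult_distr, Hrr; ring).
    assert (0 <= y ^ 6) by (apply pow_le; lra).
    assert ((- al) ^ 2 <= (1046 / 600 * z) ^ 2) by (apply pow_incr; lra).
    rewrite Rpow_mult_distr, Hz2 in *. nra. }
  assert (C : s ^ 2 / 2 * (9999 / 10000) * y ^ 2 <= 1 - cos x).
  { assert (H := one_minus_cos_ge x Hx).
    replace (s ^ 2 / 2 * (9999 / 10000) * y ^ 2) with (x ^ 2 * (9999 / 10000) / 2)
      by (unfold x; field).
    nra. }
  (* The arc stops at 1.67 because the bound for the cosine is about to become negative:
     [0.0456 * 1.67^6] is about 0.989. *)
  assert (Hy6 : 456 / 10000 * y ^ 6 <= 1).
  { apply Rle_trans with (456 / 10000 * (167 / 100) ^ 6); [|lra].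
    apply Rmult_le_compat_l; [lra|]. apply pow_incr; lra. }
  assert (H8 : 0 <= (1 - 212 / 1000 * y ^ 2) ^ 8) by (apply pow_le; lra).
  assert (HC0 : 0 <= s ^ 2 / 2 * (9999 / 10000) * y ^ 2) by (apply Rmult_le_pos; lra).
  set (q8 := (1 - 212 / 1000 * y ^ 2) ^ 8) in *.
  set (q6 := 1 - 456 / 10000 * y ^ 6) in *.
  set (q2 := s ^ 2 / 2 * (9999 / 10000) * y ^ 2) in *.
  assert (Hq6 : 0 <= q6) by (unfold q6; lra).
  assert (Hq8 : 0 <= W0 * q8) by (apply Rmult_le_pos; [now left|exact H8]).
  apply Rle_trans with ((W0 * q8) * q6 * q2); [right; unfold q2; ring|].
  apply Rmult_le_compat; [now apply Rmult_le_pos|exact HC0| |exact C].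
  now apply Rmult_le_compat.
Qed.

Lemma second_diff_integrand_ge (b : R) (K N : nat) (x : R) : 0 < b < 1 ->
  - (gf_mod (b ^ 2) K x * (1 - cos x)) <= second_diff_integrand (b ^ 2) K N x.
Proof.
intros Hb. unfold second_diff_integrand.
assert (Hb2 := pow_in_unit b 1 Hb). assert (H := gf_mod_pos (b ^ 2) K x Hb2).
assert (H1 := COS_bound x). assert (H2 := COS_bound (gf_arg (b ^ 2) K x - INR N * x)).
assert (0 <= gf_mod (b ^ 2) K x * (1 - cos x)) by (apply Rmult_le_pos; lra). nra.
Qed.

(** At [x = s y] the decay exponent is at least [c y^2] as long as [c (1 + T v^2) <= 0.999]. The
    resulting integrand [y^2 exp (- c y^2)] has no elementary primitive, so [y^2] is replaced by
    [D (2 c y^2 - 1)], which is larger for [y >= u] and leads to the primitive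
    [- D y exp (- c y^2)]. *)
Lemma middle_arc (b : R) (K N : nat) (c u v : R) : 0 < b < 1 -> tilt b <= 3 / 100 ->
  3 * (b ^ 2) ^ S K / (1 - b ^ 2) ^ 2 <= 1 / 200 ->
  let T := tilt b in let s := T * sqrt T in
  0 < u <= v -> 0 < c -> 1 < 2 * c * u ^ 2 ->
  c * (1 + T * v ^ 2) <= 999 / 1000 -> sqrt T * v <= 175 / 100 ->
  - (gf_mod (b ^ 2) K 0 * s ^ 3 / 2 * (101 / 100)
     * (u ^ 2 / (2 * c * u ^ 2 - 1) * (u * exp (- (c * u ^ 2)) - v * exp (- (c * v ^ 2)))))
  <= RInt (second_diff_integrand (b ^ 2) K N) (s * u) (s * v).
Proof.
intros Hb HTs HK T s Huv Hc Hcu Hcv Hv. fold T in HTs. assert (HT : 0 < T) by now apply tilt_pos.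
assert (Hb2 := pow_in_unit b 1 Hb).
assert (Hr : 0 < sqrt T) by now apply sqrt_lt_R0.
assert (Hrr : sqrt T ^ 2 = T) by (simpl; rewrite Rmult_1_r; apply sqrt_sqrt; lra).
assert (Hs : 0 < s) by now apply Rmult_lt_0_compat.
assert (Hs2 : s ^ 2 = T ^ 3) by (unfold s; rewrite Rpow_mult_distr, Hrr; ring).
set (W0 := gf_mod (b ^ 2) K 0). assert (HW0 : 0 < W0) by now apply gf_mod_pos.
set (D := u ^ 2 / (2 * c * u ^ 2 - 1)).
set (L := W0 * (s ^ 2 / 2) * (101 / 100)).
assert (HL : 0 < L).
{ unfold L. rewrite Hs2.
  assert (0 < W0 * T ^ 3) by (apply Rmult_lt_0_compat; trivial; apply pow_lt; lra). lra. }
replace (- (W0 * s ^ 3 / 2 * (101 / 100)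
              * (D * (u * exp (- (c * u ^ 2)) - v * exp (- (c * v ^ 2))))))
  with (s * (L * (D * v * exp (- (c * v ^ 2))) - L * (D * u * exp (- (c * u ^ 2)))))
  by (unfold L; field).
apply (RInt_ge_scaled _ (fun y => L * (D * y * exp (- (c * y ^ 2))))
  (fun y => L * (D * (1 - 2 * c * y ^ 2) * exp (- (c * y ^ 2))))); trivial.
- lra.
- intros x. now apply continuous_second_diff_integrand.
- intros y _. auto_derive; trivial. simpl. ring.
- intros y Hy. set (x := s * y).
  assert (Hx : 0 <= x) by (apply Rmult_le_pos; lra).
  assert (Hx2 : x ^ 2 = T ^ 3 * y ^ 2) by (unfold x; rewrite Rpow_mult_distr, Hs2; ring).
  assert (Hy2 : 0 < u ^ 2 <= y ^ 2) by (split; [apply pow_lt|apply pow_incr]; lra).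
  assert (HTy : T * y ^ 2 <= 49 / 16).
  { rewrite <- Hrr, <- Rpow_mult_distr. apply Rle_trans with ((175 / 100) ^ 2); [|lra].
    apply pow_incr. split; [apply Rmult_le_pos; lra|].
    apply Rle_trans with (2 := Hv). apply Rmult_le_compat_l; lra. }
  assert (HT2 : 0 < T ^ 2 <= 9 / 10000) by (split; [apply pow_lt; lra|nra]).
  assert (Hx2b : x ^ 2 <= 3 / 1000).
  { rewrite Hx2. replace (T ^ 3 * y ^ 2) with (T ^ 2 * (T * y ^ 2)) by ring.
    assert (0 <= T * y ^ 2) by (apply Rmult_le_pos; lra). nra. }
  apply Rle_trans with (2 := second_diff_integrand_ge b K N x Hb).
  apply Rle_trans with (- (L * (y ^ 2 * exp (- (c * y ^ 2))))).
  + assert (HE := exp_pos (- (c * y ^ 2))). set (E := exp (- (c * y ^ 2))) in *.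
    replace (- (L * (y ^ 2 * E))) with (L * (- y ^ 2 * E)) by ring.
    apply Rmult_le_compat_l; [lra|]. apply Rmult_le_compat_r; [lra|].
    assert (y ^ 2 <= D * (2 * c * y ^ 2 - 1)); [|lra].
    apply Rmult_le_reg_r with (2 * c * u ^ 2 - 1); [lra|].
    replace (D * (2 * c * y ^ 2 - 1) * (2 * c * u ^ 2 - 1)) with (u ^ 2 * (2 * c * y ^ 2 - 1))
      by (unfold D; field; lra).
    nra.
  + apply Ropp_le_contravar.
    assert (G := gf_mod_decay b K x Hb HK). fold T W0 in G.
    assert (Hge := one_minus_cos_ge x Hx).
    set (w := 2 * (1 - cos x)) in *.
    assert (Hx20 : 0 <= x ^ 2) by apply pow2_ge_0.
    assert (Hw : 999 / 1000 * x ^ 2 <= w) by nra.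
    assert (Hw0 : 0 < T ^ 2 + w) by lra.
    assert (He : exp (- (w / (T ^ 2 + w) / T)) <= exp (- (c * y ^ 2))).
    { assert (c * y ^ 2 <= w / (T ^ 2 + w) / T).
      { apply Rmult_le_reg_r with T; trivial.
        replace (w / (T ^ 2 + w) / T * T) with (w / (T ^ 2 + w)) by (field; lra).
        apply Rle_trans with (2 := Rdiv_add_mono (T ^ 2) (999 / 1000 * x ^ 2) w
          (proj1 HT2) ltac:(nra)).
        rewrite Hx2.
        replace (999 / 1000 * (T ^ 3 * y ^ 2) / (T ^ 2 + 999 / 1000 * (T ^ 3 * y ^ 2)))
          with (999 / 1000 * (T * y ^ 2) / (1 + 999 / 1000 * (T * y ^ 2)))
          by (field; split; nra).
        assert (Hd : 0 < 1 + 999 / 1000 * (T * y ^ 2)) by nra.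
        apply Rmult_le_reg_r with (1 + 999 / 1000 * (T * y ^ 2)); trivial.
        replace (999 / 1000 * (T * y ^ 2) / (1 + 999 / 1000 * (T * y ^ 2))
          * (1 + 999 / 1000 * (T * y ^ 2))) with (T * y ^ 2 * (999 / 1000)) by (field; lra).
        replace (c * y ^ 2 * T * (1 + 999 / 1000 * (T * y ^ 2)))
          with (T * y ^ 2 * (c * (1 + 999 / 1000 * (T * y ^ 2)))) by ring.
        apply Rmult_le_compat_l; [nra|].
        apply Rle_trans with (2 := Hcv). apply Rmult_le_compat_l; [lra|].
        assert (y ^ 2 <= v ^ 2) by (apply pow_incr; lra). nra. }
      destruct (Req_dec (- (w / (T ^ 2 + w) / T)) (- (c * y ^ 2))) as [->|]; [lra|].
      left. apply exp_increasing. lra. }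
    assert (Hcos := one_minus_cos_le x). assert (HCB := COS_bound x).
    apply Rle_trans with (W0 * (101 / 100) * exp (- (c * y ^ 2)) * (x ^ 2 / 2)).
    * apply Rmult_le_compat; [left; now apply gf_mod_pos|lra| |lra].
      apply Rle_trans with (1 := G). apply Rmult_le_compat_l; [nra|exact He].
    * right. unfold L, x. field.
Qed.

(** Past [1.75 T], slightly more than [sqrt 3 * T], one has [2 (1 - cos x) >= 3 T^2], so the
    exponent is at least [0.75 / T]. The main arc is of order [T^(9/2)], hence a bound of order
    [T^5] is good enough. *)
Lemma far_arc (b : R) (K N : nat) : 0 < b < 1 -> tilt b <= 3 / 100 ->
  3 * (b ^ 2) ^ S K / (1 - b ^ 2) ^ 2 <= 1 / 200 ->
  - (gf_mod (b ^ 2) K 0 * (8 / 1000) * tilt b ^ 5)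
  <= RInt (second_diff_integrand (b ^ 2) K N) (175 / 100 * tilt b) PI.
Proof.
intros Hb HTs HK. set (T := tilt b) in *. assert (HT : 0 < T) by now apply tilt_pos.
assert (Hb2 := pow_in_unit b 1 Hb). assert (HPI := PI2_3_2). assert (HPI4 := PI_4).
set (W0 := gf_mod (b ^ 2) K 0). assert (HW0 : 0 < W0) by now apply gf_mod_pos.
assert (HT5 : 0 < T ^ 5) by (apply pow_lt; lra).
(* [exp (0.15 / T) >= 4 / T] for [T <= 0.03], raised to the fifth power *)
assert (HE : exp (- (75 / 100 / T)) <= T ^ 5 / 1024).
{ set (u := 15 / 100 / T).
  assert (HuT : u * T = 15 / 100) by (unfold u; field; lra).
  assert (Hu : 5 <= u) by nra.
  assert (H4 : 4 / T <= exp u).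
  { replace u with (INR 5 * 1 + (u - 5)) by (simpl; ring). rewrite exp_plus, <- exp_pow.
    assert (H1 := exp_ge_cubic 1 ltac:(lra)).
    assert (H5 : (8 / 3) ^ 5 <= exp 1 ^ 5) by (apply pow_incr; lra).
    assert (H6 := exp_ineq1_le (u - 5)).
    replace (4 / T) with (80 / 3 * u) by (unfold u; field; lra).
    apply Rle_trans with ((8 / 3) ^ 5 * (u / 5)); [nra|].
    apply Rmult_le_compat; lra. }
  rewrite exp_Ropp. replace (75 / 100 / T) with (INR 5 * u) by (unfold u; simpl; field; lra).
  rewrite <- exp_pow.
  replace (T ^ 5 / 1024) with (/ (4 / T) ^ 5) by (field; lra).
  assert (0 < 4 / T) by (apply Rdiv_lt_0_compat; lra).
  apply Rinv_le_contravar; [now apply pow_lt|]. apply pow_incr. lra. }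
set (L := W0 * (101 / 100) * (T ^ 5 / 1024) * 2).
assert (HL : 0 < L) by (unfold L; assert (0 < W0 * T ^ 5) by (now apply Rmult_lt_0_compat); lra).
apply Rle_trans with (- L * PI - - L * (175 / 100 * T)).
{ assert (L * PI <= L * 4) by (apply Rmult_le_compat_l; lra).
  assert (0 < L * (175 / 100 * T)) by (apply Rmult_lt_0_compat; lra).
  assert (L * 4 <= W0 * (8 / 1000) * T ^ 5).
  { unfold L. assert (0 < W0 * T ^ 5) by now apply Rmult_lt_0_compat. lra. }
  lra. }
apply (RInt_ge_antiderivative _ (fun x => - L * x) (fun _ => - L)).
- lra.
- intros x. now apply continuous_second_diff_integrand.
- intros x _. auto_derive; trivial. ring.
- intros x Hx. apply Rle_trans with (2 := second_diff_integrand_ge b K N x Hb).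
  apply Ropp_le_contravar.
  assert (G := gf_mod_decay b K x Hb HK). fold T W0 in G.
  assert (HCB := COS_bound x).
  assert (Hcos : cos x <= cos (175 / 100 * T)) by (apply cos_decr_1; lra).
  assert (Hge := one_minus_cos_ge (175 / 100 * T) ltac:(lra)).
  assert (HT2 : 0 < T ^ 2 <= 9 / 10000) by (split; [apply pow_lt; lra|nra]).
  set (w := 2 * (1 - cos x)) in *.
  assert (Hw : 3 * T ^ 2 <= w).
  { unfold w. rewrite Rpow_mult_distr in Hge. nra. }
  assert (He : exp (- (w / (T ^ 2 + w) / T)) <= T ^ 5 / 1024).
  { apply Rle_trans with (2 := HE).
    assert (75 / 100 / T <= w / (T ^ 2 + w) / T).
    { unfold Rdiv at 1 3. apply Rmult_le_compat_r; [left; now apply Rinv_0_lt_compat|].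
      apply Rle_trans with (2 := Rdiv_add_mono (T ^ 2) (3 * T ^ 2) w (proj1 HT2) ltac:(lra)).
      right. field. lra. }
    destruct (Req_dec (- (w / (T ^ 2 + w) / T)) (- (75 / 100 / T))) as [->|]; [lra|].
    left. apply exp_increasing. lra. }
  unfold L. apply Rmult_le_compat; [left; now apply gf_mod_pos|lra| |lra].
  apply Rle_trans with (1 := G). apply Rmult_le_compat_l; [nra|exact He].
Qed.

Lemma second_diff_integral_pos (b : R) (K N : nat) : 0 < b < 1 -> tilt b <= 3 / 100 ->
  3 * (b ^ 2) ^ S K / (1 - b ^ 2) ^ 2 <= 1 / 200 ->
  sum1 (mean_term (b ^ 2)) K = INR N ->
  0 < RInt (second_diff_integrand (b ^ 2) K N) 0 PI.
Proof.
intros Hb HTs HK Hm.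
assert (H0 := main_arc b K N Hb HTs Hm).
assert (HM := fun c u v => middle_arc b K N c u v Hb HTs HK).
assert (HF := far_arc b K N Hb HTs HK).
set (T := tilt b) in *. assert (HT : 0 < T) by now apply tilt_pos.
assert (Hb2 := pow_in_unit b 1 Hb).
assert (Hr : 0 < sqrt T) by now apply sqrt_lt_R0.
assert (Hrr : sqrt T ^ 2 = T) by (simpl; rewrite Rmult_1_r; apply sqrt_sqrt; lra).
assert (Hr2 : sqrt T <= 18 / 100) by nra.
cbv zeta in H0, HM. set (s := T * sqrt T) in *.
assert (Hs : 0 < s) by now apply Rmult_lt_0_compat.
set (W0 := gf_mod (b ^ 2) K 0) in *. assert (HW0 : 0 < W0) by now apply gf_mod_pos.
set (f := second_diff_integrand (b ^ 2) K N) in *.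
assert (Hex : forall u v, ex_RInt f u v).
{ intros u v. apply (ex_RInt_continuous (V := R_CompleteNormedModule)).
  intros; now apply continuous_second_diff_integrand. }
assert (HC : forall u v w, RInt f u w = RInt f u v + RInt f v w)
  by (intros u v w; symmetry; apply (RInt_Chasles (V := R_CompleteNormedModule)); apply Hex).
(* In the scaled variable this is where [far_arc] takes over: [s * v5 = 1.75 T]. *)
set (v5 := 175 / 100 / sqrt T).
assert (Hv5 : sqrt T * v5 = 175 / 100) by (unfold v5; field; lra).
assert (Hv5T : T * v5 ^ 2 = 49 / 16).
{ rewrite <- Hrr, <- Rpow_mult_distr, Hv5. field. }
assert (Hv56 : 6 <= v5) by nra.
assert (Hsv5 : s * v5 = 175 / 100 * T) by (unfold s; rewrite Rmult_assoc, Hv5; ring).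
(* On each piece [c] is [0.999 / (1 + T v^2)] rounded down, at [T = 0.03], or with [T v^2 = 49/16]
   on the last one. *)
assert (M1 := HM (872 / 1000) (167 / 100) (22 / 10) ltac:(lra) ltac:(lra)
  ltac:(lra) ltac:(lra) ltac:(lra)).
assert (M2 := HM (786 / 1000) (22 / 10) 3 ltac:(lra) ltac:(lra)
  ltac:(lra) ltac:(lra) ltac:(lra)).
assert (M3 := HM (675 / 1000) 3 4 ltac:(lra) ltac:(lra)
  ltac:(lra) ltac:(lra) ltac:(lra)).
assert (M4 := HM (48 / 100) 4 6 ltac:(lra) ltac:(lra)
  ltac:(lra) ltac:(lra) ltac:(lra)).
assert (M5 := HM (2459 / 10000) 6 v5 ltac:(lra) ltac:(lra)
  ltac:(lra) ltac:(lra) ltac:(lra)).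
rewrite Hsv5 in M5. rewrite Rmult_0_r in H0.
rewrite (HC 0 (s * (167 / 100)) PI), (HC (s * (167 / 100)) (s * (22 / 10)) PI),
  (HC (s * (22 / 10)) (s * 3) PI), (HC (s * 3) (s * 4) PI), (HC (s * 4) (s * 6) PI),
  (HC (s * 6) (175 / 100 * T) PI).
set (Y := W0 * s ^ 3 / 2) in *.
assert (HY : 0 < Y) by (unfold Y; assert (0 < s ^ 3) by (apply pow_lt; lra);
  assert (0 < W0 * s ^ 3) by (apply Rmult_lt_0_compat; lra); lra).
assert (E1 : exp (- (872 / 1000 * (167 / 100) ^ 2)) <= 882 / 10000)
  by (apply (exp_neg_le _ _ 8); simpl; lra || lia).
(* Only the first piece needs its upper end term; the other end terms are dropped by positivity. *)
assert (E1' : 12 / 1000 <= exp (- (872 / 1000 * (22 / 10) ^ 2)))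
  by (eapply Rle_trans; [|apply (exp_neg_ge _ 64); simpl; lra || lia]; simpl; lra).
assert (E2 : exp (- (786 / 1000 * (22 / 10) ^ 2)) <= 226 / 10000)
  by (apply (exp_neg_le _ _ 8); simpl; lra || lia).
assert (E3 : exp (- (675 / 1000 * 3 ^ 2)) <= 24 / 10000)
  by (apply (exp_neg_le _ _ 16); simpl; lra || lia).
assert (E4 : exp (- (48 / 100 * 4 ^ 2)) <= 5 / 10000)
  by (apply (exp_neg_le _ _ 16); simpl; lra || lia).
assert (E5 : exp (- (2459 / 10000 * 6 ^ 2)) <= 15 / 100000)
  by (apply (exp_neg_le _ _ 16); simpl; lra || lia).
assert (P2 := exp_pos (- (786 / 1000 * 3 ^ 2))).
assert (P3 := exp_pos (- (675 / 1000 * 4 ^ 2))).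
assert (P4 := exp_pos (- (48 / 100 * 6 ^ 2))).
assert (P5 : 0 <= v5 * exp (- (2459 / 10000 * v5 ^ 2)))
  by (apply Rmult_le_pos; [lra|left; apply exp_pos]).
assert (HF' : - (Y * (3 / 1000)) <= RInt f (175 / 100 * T) PI).
{ apply Rle_trans with (2 := HF). apply Ropp_le_contravar. unfold Y.
  replace (T ^ 5) with (s ^ 3 * sqrt T).
  - assert (0 < W0 * s ^ 3) by (apply Rmult_lt_0_compat; [lra|apply pow_lt; lra]). nra.
  - unfold s. replace ((T * sqrt T) ^ 3 * sqrt T) with (T ^ 3 * (sqrt T ^ 2) ^ 2) by ring.
    rewrite Hrr. ring. }
assert (B : forall A X x, - (Y * (101 / 100) * A) <= X -> A <= x -> - (Y * (101 / 100 * x)) <= X).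
{ intros A X x H1 H2. apply Rle_trans with (2 := H1). nra. }
apply (B _ _ (88 / 1000)) in M1; [|lra].
apply (B _ _ (365 / 10000)) in M2; [|lra].
apply (B _ _ (6 / 1000)) in M3; [|lra].
apply (B _ _ (23 / 10000)) in M4; [|lra].
apply (B _ _ (2 / 1000)) in M5; [|lra].
(* In units of [Y]: 0.153 from the main arc, against [1.01 * 0.1348 + 0.003], about 0.139. *)
lra.
Qed.

(** * The saddle point, and log-concavity for large indices *)

(** At the upper end of the interval the part 1 alone already has mean [N + 1]. The bound on [a]
    does not depend on [K], which breaks a circularity: [K] has to be large in terms of [a], while
    [a] depends on [K]. *)
Lemma saddle_point_exists (K N : nat) : (0 < K)%nat -> (0 < N)%nat ->
  exists a, 0 < a <= (INR N + 1) / (INR N + 2) /\ sum1 (mean_term a) K = INR N.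
Proof.
intros HK HN. assert (HNR : 0 < INR N) by now apply lt_0_INR.
set (a1 := (INR N + 1) / (INR N + 2)).
assert (Ha1 : 0 < a1 < 1).
{ unfold a1. split; [apply Rdiv_lt_0_compat; lra|].
  apply Rmult_lt_reg_r with (INR N + 2); [lra|].
  replace ((INR N + 1) / (INR N + 2) * (INR N + 2)) with (INR N + 1) by (field; lra). lra. }
assert (H0 : sum1 (mean_term 0) K = 0).
{ clear. induction K as [|K IH]; cbn [sum1]; trivial. rewrite IH.
  unfold mean_term. rewrite pow_i by lia. rewrite Rmult_0_r, Rdiv_0_l. ring. }
assert (H1 : INR N < sum1 (mean_term a1) K).
{ assert (Hk : forall k, 0 <= mean_term a1 (S k)).
  { intros k. assert (H := pow_in_unit a1 k Ha1). unfold mean_term.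
    apply Rdiv_le_0_compat; [|lra]. apply Rmult_le_pos; [apply pos_INR|lra]. }
  destruct K as [|K]; [lia|].
  assert (H : a1 / (1 - a1) <= sum1 (mean_term a1) (S K)).
  { clear HK H0. induction K as [|K IH].
    - cbn [sum1]. unfold mean_term. rewrite pow_1. simpl. right. field. lra.
    - change (sum1 (mean_term a1) (S (S K)))
        with (sum1 (mean_term a1) (S K) + mean_term a1 (S (S K))).
      specialize (Hk (S K)). lra. }
  apply Rlt_le_trans with (2 := H). unfold a1.
  replace ((INR N + 1) / (INR N + 2) / (1 - (INR N + 1) / (INR N + 2))) with (INR N + 1)
    by (field; lra). lra. }
destruct (IVT_interv (fun a => sum1 (mean_term a) K - INR N) 0 a1) as [a [Ha Hz]].
- intros a Ha. apply continuity_pt_minus; [|apply continuity_pt_const; now intros ? ?].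
  clear H0 H1 HK. induction K as [|K IH]; cbn [sum1].
  + apply continuity_pt_const. now intros ? ?.
  + apply continuity_pt_plus; trivial.
    apply continuity_pt_filterlim, (ex_derive_continuous (K := R_AbsRing) (V := R_NormedModule)).
    unfold mean_term. auto_derive.
    assert (Hlt : a ^ S K < 1); [|simpl in *; lra].
    destruct (Req_dec a 0) as [->|Ha0]; [rewrite pow_i by lia; lra|].
    apply pow_in_unit. lra.
- lra.
- rewrite H0. lra.
- lra.
- exists a. split; [|lra]. split; [|lra].
  destruct (Req_dec a 0) as [->|]; [rewrite H0 in Hz; lra|lra].
Qed.

Lemma npart_logconcave_large (n : nat) : (1852 <= S n)%nat ->
  INR (npart n n) * INR (npart (S (S n)) (S (S n))) < INR (npart (S n) (S n)) ^ 2.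
Proof.
intros Hn. set (N := S n). assert (HN : 1852 <= INR N).
{ apply le_INR in Hn. replace (INR 1852) with 1852 in Hn; [exact Hn|].
  rewrite INR_IZR_INZ. reflexivity. }
set (a1 := (INR N + 1) / (INR N + 2)).
assert (Ea1 : 1 - a1 = / (INR N + 2)) by (unfold a1; field; lra).
assert (Hi : 0 < / (INR N + 2)) by (apply Rinv_0_lt_compat; lra).
assert (Ha1 : 0 < a1 < 1) by (split; [apply Rdiv_lt_0_compat; lra|lra]).
destruct (pow_lt_1_zero a1) with (y := (1 - a1) ^ 2 / 600) as [K0 HK0].
{ rewrite Rabs_pos_eq; lra. }
{ apply Rdiv_lt_0_compat; [apply pow_lt|]; lra. }
set (K := (K0 + S (S n))%nat).
destruct (saddle_point_exists K N) as [a [Ha Hm]]; [unfold K; lia|unfold N; lia|].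
fold a1 in Ha. set (b := sqrt a).
assert (Hba : b ^ 2 = a) by (unfold b; simpl; rewrite Rmult_1_r; apply sqrt_sqrt; lra).
assert (Hb0 : 0 < b) by (apply sqrt_lt_R0; lra).
assert (Hb : 0 < b < 1) by nra.
rewrite <- Hba in Ha, Hm.
assert (HT : 0 < tilt b) by now apply tilt_pos.
assert (HTs : tilt b <= 3 / 100).
{ assert (H := mean_le b K Hb). rewrite Hm in H.
  assert (HT2 : 0 < tilt b ^ 2) by (apply pow_lt; lra).
  assert (INR N * tilt b ^ 2 <= 5 / 3).
  { replace (5 / 3) with (5 / 3 / tilt b ^ 2 * tilt b ^ 2) by (field; lra).
    apply Rmult_le_compat_r; lra. }
  (* 1852 is the least integer [N] with [(5/3) / N <= 0.03^2]. *)
  assert (1852 * tilt b ^ 2 <= 5 / 3) by nra. nra. }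
assert (HK : 3 * (b ^ 2) ^ S K / (1 - b ^ 2) ^ 2 <= 1 / 200).
{ assert (H := HK0 (S K) ltac:(unfold K; lia)).
  rewrite Rabs_pos_eq in H by (apply pow_le; lra).
  assert (Hp : (b ^ 2) ^ S K <= a1 ^ S K) by (apply pow_incr; lra).
  assert (Hq : (1 - a1) ^ 2 <= (1 - b ^ 2) ^ 2) by (apply pow_incr; lra).
  assert (Hd : 0 < (1 - b ^ 2) ^ 2) by (apply pow_lt; lra).
  apply Rdiv_le_of_mul; lra. }
assert (H := npart_logconcave_of_integral (b ^ 2) K n (pow_in_unit b 1 Hb)
  (second_diff_integral_pos b K N Hb HTs HK Hm)).
now rewrite !(npart_stable K) in H by (unfold K; lia).
Qed.

(** * The small cases *)

Import ListNotations.
Local Open Scope N_scope.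

(* Divides the power series [l] by [1 - X ^ k]; the queue [front ++ rev rear] holds the last
   [k] coefficients of the quotient. *)
Fixpoint series_div (front rear l : list N) : list N :=
  match l with
  | [] => []
  | x :: l' =>
    match front with
    | f :: front' => let y := x + f in y :: series_div front' (y :: rear) l'
    | [] =>
      match rev_append rear [] with
      | f :: front' => let y := x + f in y :: series_div front' [y] l'
      | [] => []
      end
    end
  end.

(** [H] is [G] delayed by [k]. It is a separate function so that the queue also has a meaning on the
    first [k] indices, where [series_div_queue] makes it zero. *)
Lemma series_div_spec (F G H : nat -> N) (k len n : nat) (front rear : list N) :
  (0 < k)%nat -> (forall m, H (m + k)%nat = G m) -> (forall m, G m = F m + H m) ->
  front ++ rev rear = map H (seq n k) ->
  series_div front rear (map F (seq n len)) = map G (seq n len).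
Proof.
intros Hk HH HG. revert n front rear. induction len as [|len IH]; intros n front rear Hq;
  [reflexivity|].
assert (Hs : forall rest, H n :: rest = map H (seq n k) ->
  rest ++ [F n + H n] = map H (seq (S n) k)).
{ intros rest Hr. destruct k as [|k]; [lia|]. cbn [seq map] in Hr.
  injection Hr as Hr. rewrite Hr, seq_S, map_app. cbn [map]. do 2 f_equal.
  rewrite <- HG, <- HH. f_equal. lia. }
assert (Hh : forall f rest, f :: rest = map H (seq n k) -> f = H n).
{ intros f rest Hr. destruct k as [|k]; [lia|]. cbn [seq map] in Hr. congruence. }
cbn [seq map series_div]. destruct front as [|f front].
- rewrite rev_append_rev, app_nil_r. cbn [app] in Hq. rewrite Hq.
  destruct (map H (seq n k)) as [|f front] eqn:E.
  + apply (f_equal (@length N)) in E. rewrite length_map, length_seq in E. cbn in E. lia.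
  + rewrite <- E in Hs, Hh. assert (Hf := Hh f front (eq_sym E)). subst f.
    cbv zeta. rewrite HG. f_equal. apply IH. cbn [rev app]. now apply Hs.
- cbn [app] in Hq. assert (Hf := Hh _ _ Hq). subst f.
  cbv zeta. rewrite HG. f_equal. apply IH. cbn [rev]. rewrite app_assoc. now apply Hs.
Qed.

(* [esum J s n] counts the partitions of [n] with fewer than [J] parts, all greater than [s]:
   removing [S s] from each of [j] such parts leaves at most [j] parts, which are counted by
   [npart j] after conjugation. *)
Fixpoint esum (J s n : nat) : nat :=
  match J with
  | O => 0%nat
  | S j => (esum j s n + if (j * S s <=? n)%nat then npart j (n - j * S s) else 0)%nat
  end.

(** Either no part equals [S s], or one such part is removed. *)
Lemma esum_rec (J s n : nat) :
  esum (S J) s n = (esum (S J) (S s) n + if S s <=? n then esum J s (n - S s) else 0)%nat.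
Proof.
induction J as [|J IH].
- cbn. rewrite Nat.sub_0_r. destruct n; [reflexivity|].
  destruct (s <=? n)%nat; lia.
- change (esum (S (S J)) s n) with (esum (S J) s n
    + if (S J * S s <=? n)%nat then npart (S J) (n - S J * S s) else 0)%nat.
  change (esum (S (S J)) (S s) n) with (esum (S J) (S s) n
    + if (S J * S (S s) <=? n)%nat then npart (S J) (n - S J * S (S s)) else 0)%nat.
  change (esum (S J) s (n - S s)) with (esum J s (n - S s)
    + if (J * S s <=? n - S s)%nat then npart J (n - S s - J * S s) else 0)%nat.
  rewrite IH, (Nat.mul_succ_r (S J) (S s)), (Nat.mul_succ_l J (S s)).
  set (A := (J * S s)%nat).
  destruct (Nat.leb_spec (A + S s) n) as [H|H].
  + rewrite npart_S.
    replace (n - S s - A)%nat with (n - (A + S s))%nat by lia.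
    replace (n - (A + S s + S J))%nat with (n - (A + S s) - S J)%nat by lia.
    destruct (Nat.leb_spec (S J) (n - (A + S s))), (Nat.leb_spec (A + S s + S J) n),
      (Nat.leb_spec (S s) n), (Nat.leb_spec A (n - S s)); lia.
  + destruct (Nat.leb_spec (A + S s + S J) n), (Nat.leb_spec (S s) n),
      (Nat.leb_spec A (n - S s)); lia.
Qed.

(** [J] parts greater than [s] already sum to more than [n]. *)
Lemma esum_stable (J J' s n : nat) : (n < J * S s)%nat -> (J <= J')%nat ->
  esum J' s n = esum J s n.
Proof.
intros H. induction 1 as [|J' HJ IH]; trivial.
cbn [esum]. rewrite IH. destruct (Nat.leb_spec (J' * S s) n); [nia|lia].
Qed.

Lemma esum_0 (J n : nat) : (J <= n)%nat -> esum (S J) 0 n = npart J n.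
Proof.
induction J as [|J IH]; intros H.
- cbn. now rewrite Nat.sub_0_r.
- change (esum (S (S J)) 0 n) with (esum (S J) 0 n
    + if (S J * 1 <=? n)%nat then npart (S J) (n - S J * 1) else 0)%nat.
  rewrite IH, (npart_S J n), Nat.mul_1_r by lia. reflexivity.
Qed.

Fixpoint add_shifted (l : list N) (d : nat) (l' : list N) : list N :=
  match l with
  | [] => []
  | x :: r =>
    match d with
    | S d' => x :: add_shifted r d' l'
    | O => match l' with
           | [] => l
           | x' :: r' => (x + x') :: add_shifted r O r'
           end
    end
  end.

Lemma add_shifted_spec (f g : nat -> N) (len len' d n : nat) : (len <= len')%nat ->
  add_shifted (map f (seq n len)) d (map g (seq 0 len'))
  = map (fun i => f i + if (n + d <=? i)%nat then g (i - (n + d))%nat else 0) (seq n len).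
Proof.
assert (H0 : forall len len' n m, (len <= len')%nat ->
  add_shifted (map f (seq n len)) 0 (map g (seq m len'))
  = map (fun i => f i + g (i - n + m)%nat) (seq n len)).
{ clear. induction len as [|len IH]; intros [|len'] n m Hl; try reflexivity; [lia|].
  cbn [seq map add_shifted]. f_equal; [do 2 f_equal; lia|]. rewrite IH by lia.
  apply map_ext_in. intros i Hi. apply in_seq in Hi. do 2 f_equal. lia. }
revert d n. induction len as [|len IH]; intros d n Hl; [reflexivity|].
destruct d as [|d].
- rewrite H0 by assumption. apply map_ext_in. intros i Hi. apply in_seq in Hi.
  destruct (Nat.leb_spec (n + 0) i); [|lia]. do 2 f_equal. lia.
- cbn [seq map add_shifted]. f_equal.
  + destruct (Nat.leb_spec (n + S d) n); [lia|ring].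
  + rewrite IH by lia. apply map_ext_in. intros i Hi.
    replace (S n + d)%nat with (n + S d)%nat by lia. reflexivity.
Qed.

Fixpoint esum_table (M s J : nat) : list N * list N :=
  match J with
  | O => (1 :: repeat 0 M, repeat 0 (S M))
  | S j => let (t, acc) := esum_table M s j in
           (series_div (repeat 0 (S j)) [] t, add_shifted acc (j * S s) t)
  end.

Lemma repeat_0_map (M n : nat) : repeat 0 M = map (fun _ : nat => 0) (seq n M).
Proof.
revert n. induction M as [|M IH]; intros n; [reflexivity|]. cbn. f_equal. apply IH.
Qed.

Lemma series_div_queue (G : nat -> N) (F : nat -> N) (k len : nat) :
  (forall n, G n = F n + if (S k <=? n)%nat then G (n - S k)%nat else 0) ->
  series_div (repeat 0 (S k)) [] (map F (seq 0 len)) = map G (seq 0 len).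
Proof.
intros HG.
apply (series_div_spec _ _ (fun m => if (S k <=? m)%nat then G (m - S k)%nat else 0) (S k));
  trivial; [lia| |].
- intros m. destruct (Nat.leb_spec (S k) (m + S k)); [|lia]. f_equal. lia.
- cbn [rev]. rewrite app_nil_r, (repeat_0_map _ 0). apply map_ext_in.
  intros i Hi. apply in_seq in Hi. destruct (Nat.leb_spec (S k) i); [lia|reflexivity].
Qed.

Lemma esum_table_spec (M s J : nat) : esum_table M s J
  = (map (fun n => N.of_nat (npart J n)) (seq 0 (S M)),
     map (fun n => N.of_nat (esum J s n)) (seq 0 (S M))).
Proof.
induction J as [|J IH].
- cbn [esum_table]. f_equal; [|apply repeat_0_map].
  cbn [seq map]. change (N.of_nat (npart 0 0)) with 1. f_equal.
  rewrite <- seq_shift, map_map. apply repeat_0_map.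
- cbn [esum_table]. rewrite IH. f_equal.
  + apply series_div_queue. intros n. rewrite npart_S.
    destruct (S J <=? n)%nat; lia.
  + rewrite add_shifted_spec by lia. apply map_ext. intros n. cbn [esum Nat.add].
    destruct (J * S s <=? n)%nat; lia.
Qed.

Fixpoint div_down (k : nat) (l : list N) : list N :=
  match k with
  | O => l
  | S k' => div_down k' (series_div (repeat 0 (S k')) [] l)
  end.

(** A partition of [n] has fewer than [S n] parts, so [esum (S n) s n] counts all partitions into
    parts greater than [s]; each division then allows one more part size. *)
Lemma div_down_spec (s len : nat) :
  div_down s (map (fun n => N.of_nat (esum (S n) s n)) (seq 0 len))
  = map (fun n => N.of_nat (npart n n)) (seq 0 len).
Proof.
induction s as [|s IH]; cbn [div_down].
- apply map_ext. intros n. now rewrite esum_0.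
- rewrite <- IH. f_equal. apply series_div_queue. intros n.
  rewrite esum_rec. destruct (Nat.leb_spec (S s) n); [|lia].
  rewrite (esum_stable (S (n - S s)) n) by nia. lia.
Qed.

(* Parts at most [s] are handled by division, larger ones through [esum]; both take about
   [sqrt M] passes when [s] does. *)
Definition partition_table (M s J : nat) : list N := div_down s (snd (esum_table M s J)).

Lemma partition_table_spec (M s J : nat) : (M < J * S s)%nat ->
  partition_table M s J = map (fun n => N.of_nat (npart n n)) (seq 0 (S M)).
Proof.
intros HJ. unfold partition_table. rewrite esum_table_spec, <- (div_down_spec s).
cbn [snd]. f_equal. apply map_ext_in. intros n Hn. apply in_seq in Hn. f_equal.
rewrite <- (esum_stable J (J + S n)), <- (esum_stable (S n) (J + S n)); trivial; nia.
Qed.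

Fixpoint logconcaveb (l : list N) : bool :=
  match l with
  | x :: ((y :: z :: _) as l') => andb (x * z <? y * y) (logconcaveb l')
  | _ => true
  end.

Lemma logconcaveb_spec (g : nat -> N) (s len i : nat) :
  logconcaveb (map g (seq s len)) = true -> (s <= i)%nat -> (S (S i) < s + len)%nat ->
  g i * g (S (S i)) < g (S i) * g (S i).
Proof.
revert s. induction len as [|len IH]; intros s H Hi Hl; [lia|].
destruct len as [|[|len]]; [lia|lia|].
change (logconcaveb (map g (seq s (S (S (S len))))))
  with (andb (g s * g (S (S s)) <? g (S s) * g (S s))
         (logconcaveb (map g (seq (S s) (S (S len)))))) in H.
apply andb_prop in H. destruct H as [H1 H2].
destruct (Nat.eq_dec s i) as [<-|Hne]; [now apply N.ltb_lt|].
apply (IH (S s)); trivial; lia.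
Qed.

(** The entries kept are [p(25)] to [p(1852)], so the centres are 26 to 1851. The size 43 suffices
    since [43 * 44 = 1892 > 1852]. *)
Lemma table_logconcave : logconcaveb (skipn 25 (partition_table 1852 43 43)) = true.
Proof. vm_cast_no_check (eq_refl true). Qed.

Local Close Scope N_scope.
Local Open Scope nat_scope.

(** * From log-concavity to arbitrary gaps *)

Lemma npart_logconcave (n : nat) : 25 <= n ->
  npart n n * npart (S (S n)) (S (S n)) < npart (S n) (S n) * npart (S n) (S n).
Proof.
intros Hn. destruct (Nat.le_gt_cases 1852 (S n)) as [H|H].
- apply npart_logconcave_large in H. apply INR_lt. rewrite !mult_INR. simpl in H.
  simpl. lra.
- assert (T := table_logconcave). rewrite partition_table_spec in T by lia.
  rewrite skipn_map, skipn_seq in T.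
  apply (logconcaveb_spec _ _ _ n) in T; [|lia|lia].
  cbv beta in T. lia.
Qed.

Lemma npart_ratio_antitone (i d : nat) : 25 <= i ->
  npart i i * npart (i + S d) (i + S d) <= npart (S i) (S i) * npart (i + d) (i + d).
Proof.
intros Hi. induction d as [|d IH].
- rewrite Nat.add_0_r, Nat.add_1_r. lia.
- assert (H := npart_logconcave (i + d) ltac:(lia)).
  assert (Hp : 0 < npart (i + d) (i + d)) by (apply npart_pos; lia).
  rewrite !Nat.add_succ_r in *.
  set (x := npart (i + d) (i + d)) in *. set (y := npart (S (i + d)) (S (i + d))) in *.
  set (z := npart (S (S (i + d))) (S (S (i + d)))) in *.
  apply (Nat.mul_le_mono_pos_r _ _ x Hp). nia.
Qed.

(** With [j] fixed, moving the centre from [n] to [n + 1] multiplies the right side by the square of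
    [p(n+1) / p(n)], and the left side by two consecutive ratios at indices at least [n], neither of
    them larger. No ratio below [n = j + m] enters, so [j] itself may be small. *)
Lemma npart_midpoint_step (j m : nat) : 25 <= j + m ->
  npart j j * npart (j + m + m) (j + m + m) < npart (j + m) (j + m) ^ 2 ->
  npart j j * npart (S (S (j + m + m))) (S (S (j + m + m))) < npart (S (j + m)) (S (j + m)) ^ 2.
Proof.
intros Hm H. set (n := j + m) in *.
assert (H1 := npart_ratio_antitone n m Hm). assert (H2 := npart_ratio_antitone n (S m) Hm).
rewrite !Nat.add_succ_r in H1. rewrite !Nat.add_succ_r in H2.
assert (Hp : 0 < npart n n) by (apply npart_pos; lia).
assert (Hp1 : 0 < npart (S n) (S n)) by (apply npart_pos; lia).
set (x := npart n n) in *. set (x' := npart (S n) (S n)) in *.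
set (y0 := npart (n + m) (n + m)) in *.
set (y1 := npart (S (n + m)) (S (n + m))) in *.
set (y2 := npart (S (S (n + m))) (S (S (n + m)))) in *.
set (w := npart j j) in *.
assert (H3 : x * x * y2 <= x' * x' * y0).
{ apply Nat.le_trans with (x' * (x * y1)).
  - replace (x * x * y2) with (x * (x * y2)) by ring.
    replace (x' * (x * y1)) with (x * (x' * y1)) by ring. now apply Nat.mul_le_mono_l.
  - replace (x' * x' * y0) with (x' * (x' * y0)) by ring. now apply Nat.mul_le_mono_l. }
apply (Nat.mul_lt_mono_pos_r (x * x)); [nia|].
apply Nat.le_lt_trans with (w * (x' * x' * y0)).
- replace (w * y2 * (x * x)) with (w * (x * x * y2)) by ring. now apply Nat.mul_le_mono_l.
- replace (w * (x' * x' * y0)) with ((w * y0) * (x' * x')) by ring.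
  replace (x' ^ 2 * (x * x)) with (x ^ 2 * (x' * x')) by (simpl; ring).
  apply Nat.mul_lt_mono_pos_r; [nia|exact H].
Qed.

(** The range of [m] is 2 to [26 - j]. Ending there and not at [25 - j] keeps it nonempty for
    [j = 24], so that [m = 26 - j] can always start the induction. *)
Lemma small_midpoints :
  (let t := partition_table 52 7 7 in
   forallb (fun j => forallb (fun m =>
     (nth j t 0 * nth (j + m + m) t 0 <? nth (j + m) t 0 ^ 2)%N)
     (seq 2 (25 - j))) (seq 1 24)) = true.
Proof. vm_compute. reflexivity. Qed.

Lemma npart_midpoint_lt (j m : nat) : 1 <= j -> 2 <= m ->
  npart j j * npart (j + m + m) (j + m + m) < npart (j + m) (j + m) ^ 2.
Proof.
intros Hj Hm.
assert (Hind : forall m0, 25 <= j + m0 ->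
  npart j j * npart (j + m0 + m0) (j + m0 + m0) < npart (j + m0) (j + m0) ^ 2 ->
  m0 <= m -> npart j j * npart (j + m + m) (j + m + m) < npart (j + m) (j + m) ^ 2).
{ intros m0 H0 Hb Hle. clear Hm. induction Hle as [|m Hle IH]; trivial.
  rewrite !Nat.add_succ_r, !Nat.add_succ_l. apply npart_midpoint_step; [lia|exact IH]. }
destruct (Nat.le_gt_cases j 24) as [Hj24|Hj24].
- assert (Hsmall : forall i, 2 <= i <= 26 - j ->
    npart j j * npart (j + i + i) (j + i + i) < npart (j + i) (j + i) ^ 2).
  { intros i Hi. assert (T := small_midpoints). cbv zeta in T.
    rewrite forallb_forall in T. specialize (T j). rewrite in_seq, forallb_forall in T.
    specialize (T ltac:(lia) i). rewrite in_seq in T. specialize (T ltac:(lia)).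
    apply N.ltb_lt in T. rewrite partition_table_spec in T by lia.
    assert (Hn : forall l, l <= 52 ->
      nth l (map (fun n => N.of_nat (npart n n)) (seq 0 53)) 0%N = N.of_nat (npart l l)).
    { intros l Hl. rewrite (nth_indep _ 0%N (N.of_nat (npart 0 0)))
        by (rewrite length_map, length_seq; lia).
      rewrite (map_nth (fun n => N.of_nat (npart n n))), seq_nth by lia. reflexivity. }
    rewrite !Hn in T by lia. rewrite <- Nat2N.inj_mul in T.
    change 2%N with (N.of_nat 2) in T. rewrite <- Nat2N.inj_pow in T. lia. }
  destruct (Nat.le_gt_cases m (26 - j)) as [Hle|Hgt]; [apply Hsmall; lia|].
  apply (Hind (26 - j)); [lia|apply Hsmall; lia|lia].
(* For [j >= 25] the induction can start at gap 1, which is log-concavity itself. *)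
- apply (Hind 1); [lia| |lia]. rewrite !Nat.add_1_r, Nat.pow_2_r.
  apply npart_logconcave. lia.
Qed.

(** * Partitions as multiplicity functions *)

From mathcomp Require Import all_boot all_algebra.
Import GRing.Theory Num.Theory.
Local Open Scope ring_scope.

(** Multiplicities are capped at [m], as in the finite functions to be counted. Integer coefficients
    allow multiplication by [1 - 'X^k]. *)
Definition part_poly (m K : nat) : {poly int} :=
  \prod_(i < K) \sum_(j < m.+1) 'X^(i.+1 * j).

Lemma coef_part_poly_count (m K n : nat) :
  (part_poly m K)`_n =
  #|[set c : {ffun 'I_K -> 'I_m.+1} | \sum_(i < K) (i.+1 * c i) == n]%N|%:R.
Proof.
rewrite /part_poly bigA_distr_bigA coef_sum -sum1_card natr_sum big_mkcond /=.
rewrite [RHS]big_mkcond /=; apply: eq_bigr => c _.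
by rewrite inE -(big_morph _ (@exprD _ 'X) (expr0 _)) coefXn eq_sym; case: eqP.
Qed.

(** Multiplying by [1 - 'X^(K.+1)] telescopes the last factor to [1 - 'X^(K.+1 * m.+1)], whose
    second term has degree greater than [m]. Hence the cap does not affect coefficients up to
    [m]. *)
Lemma coef_part_polyS (m K n : nat) : (n <= m)%N ->
  (part_poly m K.+1)`_n =
  (part_poly m K)`_n + (if (K.+1 <= n)%N then (part_poly m K.+1)`_(n - K.+1) else 0).
Proof.
move=> le_nm.
have E : part_poly m K.+1 * (1 - 'X^(K.+1)) = part_poly m K * (1 - 'X^(K.+1 * m.+1)).
  rewrite /part_poly big_ord_recr /= -mulrA; congr (_ * _).
  under eq_bigr do rewrite exprM.
  by rewrite mulrC -opprB mulNr -subrX1 opprB exprM.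
have := congr1 (fun p : {poly int} => p`_n) E.
have lt_n : (n < K.+1 * m.+1)%N by apply: leq_trans (leq_pmull _ _).
rewrite !mulrBr !mulr1 !coefB !coefMXn lt_n subr0 => <-.
by rewrite ltnNge; case: (K.+1 <= n)%N; rewrite /= ?subr0 ?addr0 ?subrK.
Qed.

Lemma coef_part_poly (m K n : nat) : (n <= m)%N -> (part_poly m K)`_n = (npart K n)%:R.
Proof.
elim: K n => [|K IHK] n le_nm.
  by rewrite /part_poly big_ord0 coef1; case: n le_nm.
elim/ltn_ind: n le_nm => n IHn le_nm.
rewrite coef_part_polyS // IHK // npart_S natrD; congr (_ + _).
have -> : Nat.leb K.+1 n = (K < n)%N.
  by apply/idP/idP => [/Nat.leb_le/leP | /leP/Nat.leb_le].
case: ifP => // lt_Kn; rewrite IHn //; last exact: leq_trans (leq_subr _ _) le_nm.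
by rewrite ltn_subrL (leq_ltn_trans _ lt_Kn).
Qed.

Lemma partition_numberE (n : nat) : partition_number n = npart n n.
Proof.
apply/eqP; rewrite -(eqr_nat int) /partition_number -coef_part_poly_count.
by rewrite coef_part_poly.
Qed.

Local Close Scope ring_scope.
Local Open Scope nat_scope.

Theorem theorem5p1 (n m : nat) :
  1 < m -> m < n ->
  (partition_number (n - m) * partition_number (n + m) <
   partition_number n ^ 2)%N.
Proof.
move=> lt1m lt_mn; rewrite !partition_numberE.
have j_gt0 : 0 < n - m by rewrite subn_gt0.
have := @npart_midpoint_lt (n - m) m (elimT leP j_gt0) (elimT leP lt1m).
by rewrite !plusE (subnK (ltnW lt_mn)) Nat.pow_2_r !multE -mulnn => /ltP.
Qed.
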